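(* Let $\mathcal C$ be a modular tensor category with universal grading $\mathcal C=\bigoplus_{g\in\mathcal U(\mathcal C)}\mathcal C_g$. For every odd prime $p$ dividing $|\mathcal G(\mathcal C_{\mathrm{ad}})|$ the following hold. (a) There exists $h\in\mathcal U(\mathcal C)$, $h\neq 1$, such that $\mathcal C_h$ has at least $p$ pairwise non-isomorphic non-invertible simple objects of the same dimension. (b) If $\mathcal C$ is non-pointed, then $\operatorname{rank}(\mathcal C)\ge \operatorname{rank}(\mathcal C_{\mathrm{ad}})+|\mathcal G(\mathcal C)|+p-2$. (c) If $\mathcal C$ is odd-dimensional, then $\operatorname{rank}(\mathcal C)\ge \operatorname{rank}(\mathcal C_{\mathrm{ad}})+|\mathcal G(\mathcal C)|+2p-3$.
   Context: All categories are over an algebraically closed field of characteristic zero. A modular tensor category is a braided fusion category with a spherical structure whose $S$-matrix is invertible. The rank is the number of isomorphism classes of simple objects. $\mathcal G(\mathcal D)$ is the group of isomorphism classes of invertible objects of a fusion category $\mathcal D$. $\mathcal C_{\mathrm{ad}}$ is the adjoint subcategory, i.e. the fusion subcategory generated by all $X\otimes X^*$ with $X$ simple. The universal grading is the canonical faithful grading of $\mathcal C$ by its universal grading group $\mathcal U(\mathcal C)$, with trivial component $\mathcal C_{\mathrm{ad}}$; for modular $\mathcal C$, $\mathcal U(\mathcal C)\cong\mathcal G(\mathcal C)$. $\mathcal C$ is pointed if all simple objects are invertible, and odd-dimensional if its Frobenius-Perron dimension is an odd integer. *)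

(* Defs.v *)
From HB Require Import structures.
From mathcomp Require Import all_boot all_order all_fingroup all_algebra all_field.
From mathcomp Require Import boolp.

Set Implicit Arguments.
Unset Strict Implicit.
Unset Printing Implicit Defensive.

Import GRing.Theory Num.Theory.
Local Open Scope ring_scope.

Declare Scope cat_scope.
Delimit Scope cat_scope with cat.
Local Open Scope cat_scope.

(* Composition is written in the usual order: comp g f is "g after f". *)
Record linCat (k : fieldType) := LinCat {
  obj :> Type;
  hom : obj -> obj -> vectType k;
  idm : forall X : obj, hom X X;
  comp : forall X Y Z : obj, hom Y Z -> hom X Y -> hom X Z;
  compA : forall (W X Y Z : obj) (h : hom Y Z) (g : hom X Y) (f : hom W X),
    comp h (comp g f) = comp (comp h g) f;
  compIm : forall (X Y : obj) (f : hom X Y), comp (idm Y) f = f;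
  compmI : forall (X Y : obj) (f : hom X Y), comp f (idm X) = f;
  comp_linl : forall (X Y Z : obj) (f : hom X Y),
    linear (fun g : hom Y Z => comp g f);
  comp_linr : forall (X Y Z : obj) (g : hom Y Z),
    linear (fun f : hom X Y => comp g f)
}.

Arguments hom {k l} X Y : rename.
Arguments idm {k l} X : rename.
Arguments comp {k l X Y Z} g f : rename.

Notation "g ∘ f" := (comp g f) (at level 40, left associativity) : cat_scope.

Section LinearCategories.
Variables (k : fieldType) (C : linCat k).

Definition inverse_pair (X Y : C) (f : hom X Y) (g : hom Y X) : Prop :=
  g ∘ f = idm X /\ f ∘ g = idm Y.

Definition is_iso (X Y : C) (f : hom X Y) : Prop :=
  exists g : hom Y X, inverse_pair f g.

Definition isom (X Y : C) : Prop := exists f : hom X Y, is_iso f.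

Definition mono (X Y : C) (f : hom X Y) : Prop :=
  forall (W : C) (g h : hom W X), f ∘ g = f ∘ h -> g = h.

Definition epi (X Y : C) (f : hom X Y) : Prop :=
  forall (W : C) (g h : hom Y W), g ∘ f = h ∘ f -> g = h.

Definition is_kernel (X Y K : C) (f : hom X Y) (i : hom K X) : Prop :=
  f ∘ i = 0 /\
  forall (W : C) (g : hom W X), f ∘ g = 0 -> exists! u : hom W K, i ∘ u = g.

Definition is_cokernel (X Y Q : C) (f : hom X Y) (q : hom Y Q) : Prop :=
  q ∘ f = 0 /\
  forall (W : C) (g : hom Y W), g ∘ f = 0 -> exists! u : hom Q W, u ∘ q = g.

(* S is a direct sum of the F i; for n = 0 this says that S is a zero object. *)
Definition is_dsum (n : nat) (F : 'I_n -> C) (S : C) : Prop :=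
  exists (inj : forall i, hom (F i) S) (prj : forall i, hom S (F i)),
    [/\ forall i, prj i ∘ inj i = idm (F i),
        forall i j, i != j -> prj j ∘ inj i = 0
      & \sum_i (inj i ∘ prj i) = idm S].

Definition abelian_cat : Prop :=
  (forall (n : nat) (F : 'I_n -> C), exists S, is_dsum F S) /\
  [/\ forall (X Y : C) (f : hom X Y), exists (K : C) (i : hom K X), is_kernel f i,
      forall (X Y : C) (f : hom X Y), exists (Q : C) (q : hom Y Q), is_cokernel f q,
      forall (X Y : C) (f : hom X Y), mono f ->
        exists (Z : C) (g : hom Y Z), is_kernel g f
    & forall (X Y : C) (f : hom X Y), epi f ->
        exists (Z : C) (g : hom Z X), is_cokernel g f].

Definition nonzero (X : C) : Prop := idm X <> 0.

Definition simple_obj (X : C) : Prop :=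
  nonzero X /\
  forall (Y : C) (i : hom Y X), mono i -> i = 0 \/ is_iso i.

Definition semisimple_cat : Prop :=
  forall X : C, exists (n : nat) (F : 'I_n -> C),
    (forall i, simple_obj (F i)) /\ is_dsum F X.

(* Full subcategories are predicates on objects.  Closure under subobjects
   contains closure under isomorphism. *)
Definition full_abelian_sub (P : C -> Prop) : Prop :=
  (forall (n : nat) (F : 'I_n -> C) (S : C),
     is_dsum F S -> (forall i, P (F i)) -> P S) /\
  (forall (X Y : C) (i : hom Y X), mono i -> P X -> P Y).

End LinearCategories.

Record monCat (k : fieldType) := MonCat {
  mcat :> linCat k;
  one : mcat;
  tens : mcat -> mcat -> mcat;
  tensm : forall X Y X' Y' : mcat,
    hom X Y -> hom X' Y' -> hom (tens X X') (tens Y Y');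
  assoc : forall X Y Z : mcat, hom (tens (tens X Y) Z) (tens X (tens Y Z));
  assocV : forall X Y Z : mcat, hom (tens X (tens Y Z)) (tens (tens X Y) Z);
  lunit : forall X : mcat, hom (tens one X) X;
  lunitV : forall X : mcat, hom X (tens one X);
  runit : forall X : mcat, hom (tens X one) X;
  runitV : forall X : mcat, hom X (tens X one);
  tensm_id : forall X Y : mcat, tensm (idm X) (idm Y) = idm (tens X Y);
  tensm_comp : forall (X Y Z X' Y' Z' : mcat) (g : hom Y Z) (f : hom X Y)
      (g' : hom Y' Z') (f' : hom X' Y'),
    tensm (g ∘ f) (g' ∘ f') = tensm g g' ∘ tensm f f';
  tensm_linl : forall (X Y X' Y' : mcat) (f' : hom X' Y'),
    linear (fun f : hom X Y => tensm f f');
  tensm_linr : forall (X Y X' Y' : mcat) (f : hom X Y),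
    linear (fun f' : hom X' Y' => tensm f f');
  assocK : forall X Y Z : mcat, inverse_pair (assoc X Y Z) (assocV X Y Z);
  lunitK : forall X : mcat, inverse_pair (lunit X) (lunitV X);
  runitK : forall X : mcat, inverse_pair (runit X) (runitV X);
  assoc_nat : forall (X Y Z X' Y' Z' : mcat)
      (f : hom X X') (g : hom Y Y') (h : hom Z Z'),
    assoc X' Y' Z' ∘ tensm (tensm f g) h = tensm f (tensm g h) ∘ assoc X Y Z;
  lunit_nat : forall (X Y : mcat) (f : hom X Y),
    lunit Y ∘ tensm (idm one) f = f ∘ lunit X;
  runit_nat : forall (X Y : mcat) (f : hom X Y),
    runit Y ∘ tensm f (idm one) = f ∘ runit X;
  pentagon : forall W X Y Z : mcat,
    assoc W X (tens Y Z) ∘ assoc (tens W X) Y Z =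
    tensm (idm W) (assoc X Y Z) ∘ assoc W (tens X Y) Z
      ∘ tensm (assoc W X Y) (idm Z);
  triangle : forall X Y : mcat,
    tensm (idm X) (lunit Y) ∘ assoc X one Y = tensm (runit X) (idm Y)
}.

Arguments one {k m} : rename.
Arguments tens {k m} X Y : rename.
Arguments tensm {k m X Y X' Y'} f g : rename.
Arguments assoc {k m} X Y Z : rename.
Arguments assocV {k m} X Y Z : rename.
Arguments lunit {k m} X : rename.
Arguments lunitV {k m} X : rename.
Arguments runit {k m} X : rename.
Arguments runitV {k m} X : rename.

Notation "X ⊗ Y" := (tens X Y) (at level 38, left associativity) : cat_scope.
Notation "f ⊠ g" := (tensm f g) (at level 38, left associativity) : cat_scope.

(* Y is a left dual of X (equivalently, X is a right dual of Y). *)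
Definition is_left_dual (k : fieldType) (C : monCat k) (X Y : C)
    (ev : hom (Y ⊗ X) one) (coev : hom one (X ⊗ Y)) : Prop :=
  runit X ∘ (idm X ⊠ ev) ∘ assoc X Y X ∘ (coev ⊠ idm X) ∘ lunitV X = idm X /\
  lunit Y ∘ (ev ⊠ idm Y) ∘ assocV Y X Y ∘ (idm Y ⊠ coev) ∘ runitV Y = idm Y.

(* The family simp enumerates the isomorphism classes of simple objects, so
   its length is the rank. *)
Record fusionCat (k : fieldType) := FusionCat {
  fcat :> monCat k;
  fus_abelian : abelian_cat fcat;
  fus_semisimple : semisimple_cat fcat;
  rank : nat;
  simp : 'I_rank -> fcat;
  simp_simple : forall i, simple_obj (simp i);
  simp_inj : forall i j, isom (simp i) (simp j) -> i = j;
  simp_surj : forall X : fcat, simple_obj X -> exists i, isom X (simp i);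
  end_one : \dim {:hom (one : fcat) one} = 1%N;
  dual : fcat -> fcat;
  ev : forall X : fcat, hom (dual X ⊗ X) one;
  coev : forall X : fcat, hom one (X ⊗ dual X);
  dualP : forall X : fcat, is_left_dual (ev X) (coev X);
  right_dual : forall X : fcat, exists (Y : fcat)
    (e : hom (X ⊗ Y) one) (c : hom one (Y ⊗ X)), is_left_dual e c
}.

Arguments rank {k} f : rename.
Arguments simp {k} f i : rename.
Arguments dual {k f} X : rename.
Arguments ev {k f} X : rename.
Arguments coev {k f} X : rename.

Section FusionCategories.
Variables (k : fieldType) (C : fusionCat k).

Definition invertible (X : C) : Prop :=
  exists Y : C, isom (X ⊗ Y) one /\ isom (Y ⊗ X) one.

Definition pointed : Prop := forall X : C, simple_obj X -> invertible X.

Definition fusion_sub (P : C -> Prop) : Prop :=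
  full_abelian_sub P /\
  [/\ P one, forall X Y : C, P X -> P Y -> P (X ⊗ Y)
    & forall X : C, P X -> P (dual X)].

Definition adjoint_sub (X : C) : Prop :=
  forall P : C -> Prop, fusion_sub P ->
    (forall Y : C, simple_obj Y -> P (Y ⊗ dual Y)) -> P X.

(* Fusion subcategories being closed under subobjects, their simple objects
   are the simple objects of C they contain. *)
Definition rank_sub (P : C -> Prop) : nat := #|[set i | `[< P (simp C i) >]]|.

(* The order of the group of isomorphism classes of invertible objects of the
   fusion subcategory P; invertible objects of a fusion category are simple. *)
Definition card_inv_sub (P : C -> Prop) : nat :=
  #|[set i | `[< P (simp C i) /\ invertible (simp C i) >]]|.

Definition card_inv : nat := card_inv_sub (fun _ => True).

(* FPdim X is the largest nonnegative real eigenvalue of the matrix of left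
   multiplication by X in the Grothendieck ring. *)
Definition mult_mx (X : C) : 'M[algC]_(rank C) :=
  \matrix_(i, j) (\dim {:hom (X ⊗ simp C i) (simp C j)})%:R.

Definition FPdim (X : C) : algC :=
  \big[Num.max/0]_(a <- sval (closed_field_poly_normal (char_poly (mult_mx X)))
                   | 0 <= a) a.

Definition FPdim_cat : algC := \sum_i FPdim (simp C i) ^+ 2.

Definition odd_dimensional : Prop := exists2 n : nat, odd n & FPdim_cat = n%:R.

(* D g is the component of degree g. *)
Record grading (U : groupType) (D : U -> C -> Prop) : Prop := Grading {
  gr_sub : forall g, full_abelian_sub (D g);
  gr_hom0 : forall (g h : U) (X Y : C), g <> h -> D g X -> D h Y ->
    forall f : hom X Y, f = 0;
  gr_dec : forall X : C, exists (n : nat) (F : 'I_n -> C) (g : 'I_n -> U),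
    (forall i, D (g i) (F i)) /\ is_dsum F X;
  gr_tens : forall (g h : U) (X Y : C),
    D g X -> D h Y -> D (g * h)%g (X ⊗ Y)
}.

Definition faithful_grading (U : groupType) (D : U -> C -> Prop) : Prop :=
  forall g, exists X, D g X /\ nonzero X.

(* These conditions determine (U, D) up to a unique isomorphism. *)
Definition universal_grading (U : groupType) (D : U -> C -> Prop) : Prop :=
  [/\ grading D, faithful_grading D & forall X : C, D 1%g X <-> adjoint_sub X].

(* The morphism A -> X^* corresponding to A ⊗ X -> 1. *)
Definition mate (A X : C) (g : hom (A ⊗ X) one) : hom A (dual X) :=
  lunit (dual X) ∘ (g ⊠ idm (dual X)) ∘ assocV A X (dual X)
    ∘ (idm A ⊠ coev X) ∘ runitV A.

Definition dualm (X Y : C) (f : hom X Y) : hom (dual Y) (dual X) :=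
  mate (ev Y ∘ (idm (dual Y) ⊠ f)).

(* The canonical isomorphism Y^* ⊗ X^* -> (X ⊗ Y)^*. *)
Definition dual_tens (X Y : C) : hom (dual Y ⊗ dual X) (dual (X ⊗ Y)) :=
  mate (ev Y ∘ (idm (dual Y) ⊠ (lunit Y ∘ (ev X ⊠ idm Y) ∘ assocV (dual X) X Y))
          ∘ assoc (dual Y) (dual X) (X ⊗ Y)).

(* The last clause is monoidality of X -> X^**: both sides are morphisms
   X ⊗ Y -> (Y^* ⊗ X^* )^*. *)
Definition is_pivotal (a : forall X : C, hom X (dual (dual X))) : Prop :=
  [/\ forall X : C, is_iso (a X),
      forall (X Y : C) (f : hom X Y), a Y ∘ f = dualm (dualm f) ∘ a X
    & forall X Y : C,
        dualm (dual_tens X Y) ∘ a (X ⊗ Y) =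
        dual_tens (dual Y) (dual X) ∘ (a X ⊠ a Y)].

(* End(1) is one-dimensional; scalar_of reads off the coefficient of id_1. *)
Definition scalar_of (f : hom (one : C) one) : k :=
  coord [tuple idm (one : C)] ord0 f.

Definition ptrace (a : forall X : C, hom X (dual (dual X)))
    (X : C) (f : hom X X) : k :=
  scalar_of (ev (dual X) ∘ ((a X ∘ f) ⊠ idm (dual X)) ∘ coev X).

Definition is_spherical (a : forall X : C, hom X (dual (dual X))) : Prop :=
  is_pivotal a /\ forall X : C, ptrace a (idm X) = ptrace a (idm (dual X)).

End FusionCategories.

Record braidedFusionCat (k : fieldType) := BraidedFusionCat {
  bcat :> fusionCat k;
  braid : forall X Y : bcat, hom (X ⊗ Y) (Y ⊗ X);
  braid_iso : forall X Y : bcat, is_iso (braid X Y);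
  braid_nat : forall (X Y X' Y' : bcat) (f : hom X X') (g : hom Y Y'),
    braid X' Y' ∘ (f ⊠ g) = (g ⊠ f) ∘ braid X Y;
  hexagon1 : forall X Y Z : bcat,
    assoc Y Z X ∘ braid X (Y ⊗ Z) ∘ assoc X Y Z =
    (idm Y ⊠ braid X Z) ∘ assoc Y X Z ∘ (braid X Y ⊠ idm Z);
  hexagon2 : forall X Y Z : bcat,
    assocV Z X Y ∘ braid (X ⊗ Y) Z ∘ assocV X Y Z =
    (braid X Z ⊠ idm Y) ∘ assocV X Z Y ∘ (idm X ⊠ braid Y Z)
}.

Arguments braid {k b} X Y : rename.

Definition S_matrix (k : fieldType) (C : braidedFusionCat k)
    (a : forall X : C, hom X (dual (dual X))) : 'M[k]_(rank C) :=
  \matrix_(i, j)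
    ptrace a (braid (simp C j) (simp C i) ∘ braid (simp C i) (simp C j)).

Record modularCat (k : fieldType) := ModularCat {
  modcat :> braidedFusionCat k;
  spher : forall X : modcat, hom X (dual (dual X));
  spher_spherical : is_spherical spher;
  S_unit : S_matrix spher \in unitmx
}.

(* Main.v *)
From HB Require Import structures.
From mathcomp Require Import all_boot all_order all_fingroup all_algebra all_field.
From mathcomp Require Import cyclic pgroup boolp.
From mathcomp Require Import zify.
Require Import Defs.

Set Implicit Arguments.
Unset Strict Implicit.
Unset Printing Implicit Defensive.

Import GRing.Theory VectorInternalTheory.
Local Open Scope ring_scope.
Local Open Scope cat_scope.

(** Let G be the group of invertible objects of C, and for a in G and a simple
    object X let b(a, X) be the scalar by which the double braiding acts on
    a ⊗ X. This pairing is multiplicative in X and in a, and it is trivial when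
    X lies in the adjoint subcategory: objects with trivial monodromy with a
    form a fusion subcategory that contains every Y ⊗ Y^*
    ([monodromy_adjoint]). Pivotal dimensions are multiplicative
    ([cdim_tens]), so the row of the S-matrix at a has entries
    d_a b(a, X) d_X. As S is invertible, the functions b(a, _) are linearly
    independent ([row_free_mchar]). Call two simple objects of the same class
    when all b(a, _) agree on them. Independence gives at least |G| classes
    ([card_classes]).

    By Cauchy's theorem the adjoint subcategory contains an invertible object
    g of order p ([adj_cauchy]). It has the class of the unit, so the
    invertible objects meet fewer than |G| classes; by independence, b(g, _)
    is not identically 1. A group is not the union of two proper subgroups: there is
    a simple object z with b(g, z) <> 1 whose class contains no invertible
    object ([separating_class]).

    Tensoring with g permutes the objects of each class. The central point is
    that no X with b(g, X) <> 1 is fixed. If g ⊗ X were isomorphic to X, a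
    strand g could be emitted from a closed loop X, taken once around the
    loop and absorbed again; the loop is multiplication by a nonzero scalar,
    and going around costs b(g, X) once the self-braiding of g is trivial
    ([loop_slide], [fixed_monodromy]). The self-braiding of g is a sign whose
    p-th power is 1, so it is trivial for odd p ([selfbr_odd]). Hence g acts
    freely on the class of z, which yields p objects g^n ⊗ z. They are not
    invertible, they lie in the component of z of the universal grading
    because g lies in the trivial one, and they have the same Frobenius-Perron
    dimension because their fusion matrices are conjugate under a permutation
    ([FPdim_act]). This is (a).

    For (b), count simple objects class by class: the class of the unit
    contains the adjoint simple objects, the class of z has at least p
    elements, and each of the other classes, at least |G| - 2 in number, has
    at least one. For (c), the class of the dual of z is another one with at
    least p elements, since b(g, z) is a nontrivial p-th root of unity and p
    is odd, so that it differs from its inverse.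

    String diagrams are computed without strictification: words of objects
    are nested to the right and end with a spectator object, which makes
    whiskering definitional and removes all associators once a few basic
    identities are known ([pad], [snakeZ], [braidZ_hexl]). *)

(** * Linear categories and Schur's lemma *)

Lemma dim_inj (k : fieldType) (U V : vectType k) (f : U -> V) :
  linear f -> injective f -> (\dim {:U} <= \dim {:V})%N.
Proof.
move=> f_lin f_inj.
pose F : {linear U -> V} := HB.pack f (GRing.isLinear.Build _ _ _ _ f f_lin).
have kerF : lker (linfun F) == 0%VS.
  by apply/lker0P => x y; rewrite !lfunE; apply: f_inj.
by rewrite -(limg_dim_eq (f := linfun F)) ?dimvS ?subvf // (eqP kerF) capv0.
Qed.

Lemma dim1_scalar (k : fieldType) (V : vectType k) (v : V) :
  \dim {:V} = 1%N -> v != 0 -> forall w : V, exists c, w = c *: v.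
Proof.
move=> dimV v_neq0 w; apply/vlineP.
suff -> : <[v]>%VS = fullv by apply: memvf.
by apply/eqP; rewrite eqEdim subvf dim_vline v_neq0 dimV.
Qed.

Lemma linear_eigen (k : closedFieldType) (V : vectType k) (f : V -> V) (v : V) :
  linear f -> v != 0 -> exists c (u : V), u != 0 /\ f u = c *: u.
Proof.
move=> f_lin v_neq0.
pose F : {linear V -> V} := HB.pack f (GRing.isLinear.Build _ _ _ _ f f_lin).
pose g (x : 'rV[k]_(dim V)) := v2r (F (r2v x)).
have g_lin : linear g by move=> a x y; rewrite /g linearP linearP linearP.
pose G : {linear 'rV[k]_(dim V) -> 'rV[k]_(dim V)} :=
  HB.pack g (GRing.isLinear.Build _ _ _ _ g g_lin).
have /closed_rootP [c] : size (char_poly (lin1_mx G)) != 1%N.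
  rewrite size_char_poly eqSS -dimvf dimv_eq0.
  apply: contra v_neq0 => /eqP V0; rewrite -memv0 -V0; exact: memvf.
rewrite -eigenvalue_root_char => /eigenvalueP [x xG x_neq0].
exists c, (r2v x); split.
  by apply: contra x_neq0 => /eqP x0; rewrite -[x]r2vK x0 linear0.
apply: v2r_inj; move: xG; rewrite mul_rV_lin1 /= /g => ->.
by rewrite linearZ /= r2vK.
Qed.

Section Linear.
Variables (k : fieldType) (C : linCat k).
Implicit Types X Y Z : C.

Lemma compDl X Y Z (g g' : hom Y Z) (f : hom X Y) :
  (g + g') ∘ f = g ∘ f + g' ∘ f.
Proof. by have := comp_linl f 1 g g'; rewrite !scale1r. Qed.

Lemma compDr X Y Z (g : hom Y Z) (f f' : hom X Y) :
  g ∘ (f + f') = g ∘ f + g ∘ f'.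
Proof. by have := comp_linr g 1 f f'; rewrite !scale1r. Qed.

Lemma comp0l X Y Z (f : hom X Y) : (0 : hom Y Z) ∘ f = 0.
Proof. by apply: (addrI (0 ∘ f)); rewrite -compDl !addr0. Qed.

Lemma comp0r X Y Z (g : hom Y Z) : g ∘ (0 : hom X Y) = 0.
Proof. by apply: (addrI (g ∘ 0)); rewrite -compDr !addr0. Qed.

Lemma compZl X Y Z c (g : hom Y Z) (f : hom X Y) : (c *: g) ∘ f = c *: (g ∘ f).
Proof. by have := comp_linl f c g 0; rewrite comp0l !addr0. Qed.

Lemma compZr X Y Z c (g : hom Y Z) (f : hom X Y) : g ∘ (c *: f) = c *: (g ∘ f).
Proof. by have := comp_linr g c f 0; rewrite comp0r !addr0. Qed.

Lemma comp_sumr X Y Z n (g : hom Y Z) (F : 'I_n -> hom X Y) :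
  g ∘ (\sum_i F i) = \sum_i (g ∘ F i).
Proof. by apply: (big_morph (comp g)) => [f f'|]; rewrite ?compDr ?comp0r. Qed.

Lemma compBr X Y Z (g : hom Y Z) (f f' : hom X Y) :
  g ∘ (f - f') = g ∘ f - g ∘ f'.
Proof. by rewrite -scaleN1r compDr compZr scaleN1r. Qed.

Lemma compBl X Y Z (g g' : hom Y Z) (f : hom X Y) :
  (g - g') ∘ f = g ∘ f - g' ∘ f.
Proof. by rewrite -scaleN1r compDl compZl scaleN1r. Qed.

Lemma inverse_pairC X Y (f : hom X Y) g : inverse_pair f g -> inverse_pair g f.
Proof. by case. Qed.

Lemma isom_refl X : isom X X.
Proof. by exists (idm X), (idm X); split; rewrite compIm. Qed.

Lemma isom_sym X Y : isom X Y -> isom Y X.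
Proof. by move=> [f [g fg]]; exists g, f; apply: inverse_pairC. Qed.

Lemma is_iso_comp X Y Z (g : hom Y Z) (f : hom X Y) :
  is_iso g -> is_iso f -> is_iso (g ∘ f).
Proof.
move=> [g' [g'g gg']] [f' [f'f ff']]; exists (f' ∘ g'); split.
  by rewrite -compA [g' ∘ _]compA g'g compIm.
by rewrite -compA [f ∘ _]compA ff' compIm.
Qed.

Lemma isom_trans Y X Z : isom X Y -> isom Y Z -> isom X Z.
Proof.
by move=> [f f_iso] [g g_iso]; exists (g ∘ f); apply: is_iso_comp.
Qed.

Lemma iso_injl X Y Z (g : hom Y Z) : is_iso g -> injective (@comp _ _ X Y Z g).
Proof.
move=> [g' [g'g _]] f f' eq_gf.
by rewrite -[f]compIm -[f']compIm -g'g -!compA eq_gf.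
Qed.

Lemma iso_injr X Y Z (f : hom X Y) :
  is_iso f -> injective (fun g : hom Y Z => g ∘ f).
Proof.
move=> [f' [_ ff']] g g' eq_gf.
by rewrite -[g]compmI -[g']compmI -ff' !compA eq_gf.
Qed.

Lemma iso_mono X Y (f : hom X Y) : is_iso f -> mono f.
Proof. by move=> f_iso W; apply: iso_injl. Qed.

Lemma mono_comp X Y Z (g : hom Y Z) (f : hom X Y) :
  mono g -> mono f -> mono (g ∘ f).
Proof. by move=> gM fM W u v; rewrite -!compA => /gM /fM. Qed.

Lemma isom_dim_le X Y X' Y' : isom X X' -> isom Y Y' ->
  (\dim {:hom X Y} <= \dim {:hom X' Y'})%N.
Proof.
move=> [f [f' [f'f ff']]] [g g_iso].
apply: (@dim_inj _ _ _ (fun h => g ∘ (h ∘ f'))) => [c h h'|h h'].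
  by rewrite compDl compDr compZl compZr.
move/(iso_injl g_iso); apply: iso_injr; by exists f.
Qed.

Lemma isom_dim X Y X' Y' : isom X X' -> isom Y Y' ->
  \dim {:hom X Y} = \dim {:hom X' Y'}.
Proof.
move=> XX' YY'; apply/eqP; rewrite eqn_leq !isom_dim_le //; exact: isom_sym.
Qed.

Lemma isom_nonzero X Y : isom X Y -> nonzero X -> nonzero Y.
Proof.
move=> [f [g [gf fg]]] X_neq0 idY0; apply: X_neq0.
by rewrite -gf -[f]compIm idY0 comp0l comp0r.
Qed.

Lemma isom_simple X Y : isom X Y -> simple_obj X -> simple_obj Y.
Proof.
move=> XY [X_neq0 Xsub]; split; first exact: isom_nonzero XY X_neq0.
case: XY => f [g [gf fg]] W i iM.
have g_iso : is_iso g by exists f.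
case: (Xsub W (g ∘ i)) => [|gi0|[h [hgi gih]]].
- by apply: mono_comp => //; apply: iso_mono.
- by left; apply: (iso_injl g_iso); rewrite gi0 comp0r.
right; exists (h ∘ g); split; first by rewrite -compA.
by rewrite -[RHS]fg -[f in RHS]compmI -gih -!compA [f ∘ (g ∘ _)]compA fg compIm.
Qed.

Lemma simple_mono_iso X Y (f : hom X Y) :
  nonzero X -> simple_obj Y -> mono f -> is_iso f.
Proof.
move=> X_neq0 [_ Ysub] fM; case: (Ysub _ f fM) => // f0.
by case: X_neq0; apply: fM; rewrite f0 !comp0l.
Qed.

Lemma simple_hom_iso X Y (f : hom X Y) :
  abelian_cat C -> simple_obj X -> simple_obj Y -> f <> 0 -> is_iso f.
Proof.
move=> [_ [kerE _ _ _]] [X_neq0 Xsub] Y_simple f_neq0.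
apply: simple_mono_iso => //.
have [K [i [fi0 iP]]] := kerE _ _ f.
have iM : mono i.
  move=> W u v iu_iv.
  have fiv : f ∘ (i ∘ v) = 0 by rewrite compA fi0 comp0l.
  have [w [_ w_uniq]] := iP _ _ fiv.
  by rewrite -(w_uniq u iu_iv) (w_uniq v).
case: (Xsub _ i iM) => [i0 W u v fu_fv|i_iso]; last first.
  by case: f_neq0; apply: (iso_injr i_iso); rewrite /= fi0 comp0l.
apply/eqP; rewrite -subr_eq0; apply/eqP.
have fuv : f ∘ (u - v) = 0 by rewrite compBr fu_fv subrr.
by have [w [<- _]] := iP _ _ fuv; rewrite i0 comp0l.
Qed.

(** The composite of a projection and an injection is a scalar, so a single
    nonzero summand already fills X. *)
Lemma simple_dsum1 X n (F : 'I_n -> C) : (forall f : hom X X, exists c, f = c *: idm X) ->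
  nonzero X -> (forall i, simple_obj (F i)) -> is_dsum F X -> exists i, isom X (F i).
Proof.
move=> endX X_neq0 Fs [inj [prj [pi_id _ sum_ip]]].
case: n F Fs inj prj pi_id sum_ip => [|n] F Fs inj prj pi_id sum_ip.
  by case: X_neq0; rewrite -sum_ip big_ord0.
exists ord0, (prj ord0).
have [c ip_c] := endX (inj ord0 ∘ prj ord0).
have c_neq0 : c != 0.
  apply/eqP => c0; case: (Fs ord0) => + _; apply.
  have := pi_id ord0; rewrite -{1}[prj ord0]compmI.
  rewrite -[LHS]compIm -{1}(pi_id ord0) -!compA [inj _ ∘ (prj _ ∘ _)]compA.
  by rewrite ip_c c0 scale0r !comp0l comp0r.
exists (c^-1 *: inj ord0); split; first by rewrite compZl ip_c scalerA mulVf ?scale1r.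
have cid : idm (F ord0) = c *: idm (F ord0).
  rewrite -[LHS](pi_id ord0) -[inj ord0 in LHS]compmI -(pi_id ord0).
  by rewrite [inj _ ∘ (_ ∘ _)]compA ip_c !compZl compZr compIm.
by rewrite compZr pi_id {1}cid scalerA mulVf // scale1r.
Qed.

End Linear.

Section Schur.
Variables (k : closedFieldType) (C : linCat k).
Implicit Types X Y Z : C.

Lemma simple_end X (f : hom X X) :
  abelian_cat C -> simple_obj X -> exists c, f = c *: idm X.
Proof.
move=> C_ab X_simple.
have /eqP idX_neq0 : idm X <> 0 by case: X_simple.
have [c [u [u_neq0 fu]]] := linear_eigen (comp_linr f) idX_neq0.
exists c; apply/eqP; rewrite -subr_eq0; apply/eqP.
apply: contrapT => fc_neq0; case/eqP: u_neq0.
apply: (iso_injl (simple_hom_iso C_ab X_simple X_simple fc_neq0)).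
by rewrite compBl fu compZl compIm subrr comp0r.
Qed.

Lemma simple_dim1 X : abelian_cat C -> simple_obj X -> \dim {:hom X X} = 1%N.
Proof.
move=> C_ab X_simple.
have idX_neq0 : idm X != 0 by apply/eqP; case: X_simple.
suff <- : <[idm X]>%VS = fullv by rewrite dim_vline idX_neq0.
apply/eqP; rewrite eqEsubv subvf; apply/subvP => f _.
by have [c ->] := simple_end f C_ab X_simple; rewrite memvZ ?memv_line.
Qed.

End Schur.

(** * Monoidal categories: right-nested words with a spectator *)

Notation "X ◁ f" := (idm X ⊠ f) (at level 38, left associativity) : cat_scope.
Notation "f ▷ Z" := (f ⊠ idm Z) (at level 38, left associativity) : cat_scope.

Section Reassociation.
Variables (k : fieldType) (C : linCat k).

(** Composites are kept nested to the right. The lemmas ra2, ra3 and ra4 let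
    an equation between short composites rewrite the beginning of a longer
    one. *)
Lemma ra2 (W X Y Z : C) (a : hom Y Z) (b : hom X Y) (c : hom X Z) :
  a ∘ b = c -> forall x : hom W X, a ∘ (b ∘ x) = c ∘ x.
Proof. by move=> <- x; rewrite compA. Qed.

Lemma ra3 (V W X Y Z : C) (a : hom Y Z) (b : hom X Y) (c : hom W X) (d : hom W Z) :
  a ∘ (b ∘ c) = d -> forall x : hom V W, a ∘ (b ∘ (c ∘ x)) = d ∘ x.
Proof. by move=> <- x; rewrite !compA. Qed.

Lemma ra4 (U V W X Y Z : C) (a : hom Y Z) (b : hom X Y) (c : hom W X)
    (d : hom V W) (e : hom V Z) :
  a ∘ (b ∘ (c ∘ d)) = e -> forall x : hom U V, a ∘ (b ∘ (c ∘ (d ∘ x))) = e ∘ x.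
Proof. by move=> <- x; rewrite !compA. Qed.

End Reassociation.

Section Monoidal.
Variables (k : fieldType) (C : monCat k).
Implicit Types V W X Y Z : C.

Lemma wl_comp X Y Y' Y'' (g : hom Y' Y'') (f : hom Y Y') :
  X ◁ (g ∘ f) = (X ◁ g) ∘ (X ◁ f).
Proof. by rewrite -tensm_comp compIm. Qed.

Lemma wr_comp X Y Y' Y'' (g : hom Y' Y'') (f : hom Y Y') :
  (g ∘ f) ▷ X = (g ▷ X) ∘ (f ▷ X).
Proof. by rewrite -tensm_comp compIm. Qed.

Lemma tensm_lr X X' Y Y' (f : hom X X') (g : hom Y Y') :
  f ⊠ g = (f ▷ Y') ∘ (X ◁ g).
Proof. by rewrite -tensm_comp compIm compmI. Qed.

Lemma tensm_rl X X' Y Y' (f : hom X X') (g : hom Y Y') :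
  f ⊠ g = (X' ◁ g) ∘ (f ▷ Y).
Proof. by rewrite -tensm_comp compIm compmI. Qed.

Lemma xchg X X' Y Y' (f : hom X X') (g : hom Y Y') :
  (f ▷ Y') ∘ (X ◁ g) = (X' ◁ g) ∘ (f ▷ Y).
Proof. by rewrite -tensm_lr tensm_rl. Qed.

Lemma wlD X Y Y' (g g' : hom Y Y') : X ◁ (g + g') = X ◁ g + X ◁ g'.
Proof. by have := tensm_linr (idm X) 1 g g'; rewrite !scale1r. Qed.

Lemma wl0 X Y Y' : X ◁ (0 : hom Y Y') = 0.
Proof. by apply: (addrI (X ◁ (0 : hom Y Y'))); rewrite -wlD !addr0. Qed.

Lemma wlZ X Y Y' c (f : hom Y Y') : X ◁ (c *: f) = c *: (X ◁ f).
Proof. by have := tensm_linr (idm X) c f 0; rewrite wl0 !addr0. Qed.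

Lemma wl_sum X Y Y' n (F : 'I_n -> hom Y Y') :
  X ◁ (\sum_i F i) = \sum_i (X ◁ F i).
Proof.
by apply: (big_morph (fun f => X ◁ f)) => [f g|]; rewrite ?wlD ?wl0.
Qed.

Lemma wrD X Y Y' (g g' : hom Y Y') : (g + g') ▷ X = g ▷ X + g' ▷ X.
Proof. by have := tensm_linl (idm X) 1 g g'; rewrite !scale1r. Qed.

Lemma wr0 X Y Y' : (0 : hom Y Y') ▷ X = 0.
Proof. by apply: (addrI ((0 : hom Y Y') ▷ X)); rewrite -wrD !addr0. Qed.

Lemma wrZ X Y Y' c (f : hom Y Y') : (c *: f) ▷ X = c *: (f ▷ X).
Proof. by have := tensm_linl (idm X) c f 0; rewrite wr0 !addr0. Qed.

Lemma assocVK X Y Z : assocV X Y Z ∘ assoc X Y Z = idm _.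
Proof. by case: (assocK X Y Z). Qed.
Lemma assocKV X Y Z : assoc X Y Z ∘ assocV X Y Z = idm _.
Proof. by case: (assocK X Y Z). Qed.
Lemma lunitKV X : lunit X ∘ lunitV X = idm _.
Proof. by case: (lunitK X). Qed.
Lemma runitKV X : runit X ∘ runitV X = idm _.
Proof. by case: (runitK X). Qed.

Lemma assoc_iso X Y Z : is_iso (assoc X Y Z).
Proof. by exists (assocV X Y Z); apply: assocK. Qed.
Lemma assocV_iso X Y Z : is_iso (assocV X Y Z).
Proof. by exists (assoc X Y Z); apply/inverse_pairC/assocK. Qed.
Lemma lunit_iso X : is_iso (lunit X).
Proof. by exists (lunitV X); apply: lunitK. Qed.
Lemma lunitV_iso X : is_iso (lunitV X).
Proof. by exists (lunit X); apply/inverse_pairC/lunitK. Qed.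
Lemma runit_iso X : is_iso (runit X).
Proof. by exists (runitV X); apply: runitK. Qed.

Lemma tensm_iso X X' Y Y' (f : hom X X') (g : hom Y Y') :
  is_iso f -> is_iso g -> is_iso (f ⊠ g).
Proof.
move=> [f' [f'f ff']] [g' [g'g gg']]; exists (f' ⊠ g'); split.
  by rewrite -tensm_comp f'f g'g tensm_id.
by rewrite -tensm_comp ff' gg' tensm_id.
Qed.

Lemma idm_iso X : is_iso (idm X).
Proof. by exists (idm X); split; rewrite compIm. Qed.

Lemma isom_tens X X' Y Y' : isom X X' -> isom Y Y' -> isom (X ⊗ Y) (X' ⊗ Y').
Proof. by move=> [f fi] [g gi]; exists (f ⊠ g); apply: tensm_iso. Qed.

Lemma isom_assoc X Y Z : isom ((X ⊗ Y) ⊗ Z) (X ⊗ (Y ⊗ Z)).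
Proof. by exists (assoc X Y Z); apply: assoc_iso. Qed.
Lemma isom_lunit X : isom (one ⊗ X) X.
Proof. by exists (lunit X); apply: lunit_iso. Qed.
Lemma isom_runit X : isom (X ⊗ one) X.
Proof. by exists (runit X); apply: runit_iso. Qed.

Lemma wlZidm X Y c : X ◁ (c *: idm Y) = c *: idm (X ⊗ Y).
Proof. by rewrite wlZ tensm_id. Qed.
Lemma wrZidm X Y c : (c *: idm Y) ▷ X = c *: idm (Y ⊗ X).
Proof. by rewrite wrZ tensm_id. Qed.

Lemma assoc_wl X Y Z Z' (h : hom Z Z') :
  assoc X Y Z' ∘ ((X ⊗ Y) ◁ h) = (X ◁ (Y ◁ h)) ∘ assoc X Y Z.
Proof. by rewrite -assoc_nat tensm_id. Qed.
Lemma assoc_wm X Y Y' Z (h : hom Y Y') :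
  assoc X Y' Z ∘ ((X ◁ h) ▷ Z) = (X ◁ (h ▷ Z)) ∘ assoc X Y Z.
Proof. by rewrite assoc_nat. Qed.
Lemma assoc_wr X X' Y Z (h : hom X X') :
  assoc X' Y Z ∘ ((h ▷ Y) ▷ Z) = (h ▷ (Y ⊗ Z)) ∘ assoc X Y Z.
Proof. by rewrite assoc_nat tensm_id. Qed.

Lemma assocV_nat X Y Z X' Y' Z' (f : hom X X') (g : hom Y Y') (h : hom Z Z') :
  assocV X' Y' Z' ∘ (f ⊠ (g ⊠ h)) = ((f ⊠ g) ⊠ h) ∘ assocV X Y Z.
Proof.
apply: (iso_injl (assoc_iso X' Y' Z')); rewrite compA assocKV compIm.
by rewrite compA assoc_nat -compA assocKV compmI.
Qed.

Lemma assocV_wl X Y Z Z' (h : hom Z Z') :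
  assocV X Y Z' ∘ (X ◁ (Y ◁ h)) = ((X ⊗ Y) ◁ h) ∘ assocV X Y Z.
Proof. by rewrite assocV_nat tensm_id. Qed.
Lemma assocV_wm X Y Y' Z (h : hom Y Y') :
  assocV X Y' Z ∘ (X ◁ (h ▷ Z)) = ((X ◁ h) ▷ Z) ∘ assocV X Y Z.
Proof. by rewrite assocV_nat. Qed.
Lemma assocV_wr X X' Y Z (h : hom X X') :
  assocV X' Y Z ∘ (h ▷ (Y ⊗ Z)) = ((h ▷ Y) ▷ Z) ∘ assocV X Y Z.
Proof. by rewrite -assocV_nat tensm_id. Qed.

Lemma lunitV_nat X Y (f : hom X Y) : lunitV Y ∘ f = (one ◁ f) ∘ lunitV X.
Proof.
apply: (iso_injl (lunit_iso Y)); rewrite !compA lunitKV compIm.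
by rewrite lunit_nat -compA lunitKV compmI.
Qed.

Lemma wl1_inj X Y (f g : hom X Y) : (one : C) ◁ f = (one : C) ◁ g -> f = g.
Proof.
by move=> fg; apply: (iso_injr (lunit_iso X)); rewrite -!lunit_nat fg.
Qed.

Lemma wr1_inj X Y (f g : hom X Y) : f ▷ (one : C) = g ▷ (one : C) -> f = g.
Proof.
by move=> fg; apply: (iso_injr (runit_iso X)); rewrite -!runit_nat fg.
Qed.

Lemma pentagon_r W X Y Z :
  assoc W X (Y ⊗ Z) ∘ (assoc (W ⊗ X) Y Z ∘ (assocV W X Y ▷ Z)) =
  (W ◁ assoc X Y Z) ∘ assoc W (X ⊗ Y) Z.
Proof.
by rewrite compA pentagon -!compA -wr_comp assocKV tensm_id compmI.
Qed.

Lemma pentagon_m W X Y Z :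
  assocV W X (Y ⊗ Z) ∘ (W ◁ assoc X Y Z) =
  assoc (W ⊗ X) Y Z ∘ ((assocV W X Y ▷ Z) ∘ assocV W (X ⊗ Y) Z).
Proof.
apply: (iso_injl (assoc_iso _ _ _)); rewrite compA assocKV compIm.
rewrite !compA -[_ ∘ assoc (W ⊗ X) _ _ ∘ _]compA pentagon_r.
by rewrite -compA assocKV compmI.
Qed.

Lemma pentagon_V W X Y Z :
  (assocV W X Y ▷ Z) ∘ (assocV W (X ⊗ Y) Z ∘ (W ◁ assocV X Y Z)) =
  assocV (W ⊗ X) Y Z ∘ assocV W X (Y ⊗ Z).
Proof.
apply: (iso_injl (assoc_iso _ _ _)).
rewrite compA [RHS]compA assocKV compIm.
rewrite compA -[_ ∘ assocV W (X ⊗ Y) Z]compA -pentagon_m -compA -wl_comp.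
by rewrite assocKV tensm_id compmI.
Qed.

(** Coherence of the unit, due to Kelly: tensoring with the unit is
    faithful, and after tensoring, the pentagon and the triangle for 1, 1,
    X, Y give the equation. *)
Lemma lunit_tens X Y : lunit (X ⊗ Y) ∘ assoc one X Y = lunit X ▷ Y.
Proof.
apply: wl1_inj.
apply: (iso_injr (assoc_iso one (one ⊗ X) Y)).
apply: (iso_injr (tensm_iso (assoc_iso one one X) (idm_iso Y))) => /=.
rewrite wl_comp -!compA.
have -> : (one ◁ assoc one X Y) ∘ (assoc one (one ⊗ X) Y ∘ (assoc one one X ▷ Y))
   = assoc one one (X ⊗ Y) ∘ assoc (one ⊗ one) X Y.
  by rewrite pentagon compA.
rewrite compA triangle -tensm_id -assoc_nat -triangle wr_comp compA.
by rewrite assoc_wm compA.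
Qed.

Lemma lunitV_tens X Y : lunitV (X ⊗ Y) = assoc one X Y ∘ (lunitV X ▷ Y).
Proof.
apply: (iso_injl (lunit_iso _)).
by rewrite lunitKV compA lunit_tens -wr_comp lunitKV tensm_id.
Qed.

Lemma triangleV X Y : (X ◁ lunit Y) = (runit X ▷ Y) ∘ assocV X one Y.
Proof. by rewrite -triangle -compA assocKV compmI. Qed.

(** Coherence is absorbed by letting words act on a spectator object Z: a
    morphism u from X ⊗ Y to W becomes a natural family of morphisms from X
    ⊗ (Y ⊗ Z) to W ⊗ Z. On right-nested words, whiskering on the left is X ◁
    _, whiskering on the right substitutes a tensor product for Z, and
    string- diagram identities contain no associators. The bodies are locked
    because they are composites, which rewriting with associativity would
    otherwise take apart. *)
Definition pad X Y W (u : hom (X ⊗ Y) W) Z : hom (X ⊗ (Y ⊗ Z)) (W ⊗ Z) :=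
  locked ((u ▷ Z) ∘ assocV X Y Z).

Lemma padE X Y W (u : hom (X ⊗ Y) W) Z : pad u Z = (u ▷ Z) ∘ assocV X Y Z.
Proof. by rewrite /pad -lock. Qed.

Definition pairZ X Y (u : hom (X ⊗ Y) one) Z : hom (X ⊗ (Y ⊗ Z)) Z :=
  locked (lunit Z ∘ pad u Z).

Lemma pairZE X Y (u : hom (X ⊗ Y) one) Z : pairZ u Z = lunit Z ∘ pad u Z.
Proof. by rewrite /pairZ -lock. Qed.

Definition copairZ X Y (u : hom one (X ⊗ Y)) Z : hom Z (X ⊗ (Y ⊗ Z)) :=
  locked (assoc X Y Z ∘ ((u ▷ Z) ∘ lunitV Z)).

Lemma copairZE X Y (u : hom one (X ⊗ Y)) Z :
  copairZ u Z = assoc X Y Z ∘ ((u ▷ Z) ∘ lunitV Z).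
Proof. by rewrite /copairZ -lock. Qed.

Lemma pad_nat X Y W (u : hom (X ⊗ Y) W) Z Z' (h : hom Z Z') :
  pad u Z' ∘ (X ◁ (Y ◁ h)) = (W ◁ h) ∘ pad u Z.
Proof. by rewrite !padE -compA assocV_wl compA xchg -compA. Qed.

Lemma pairZ_nat X Y (u : hom (X ⊗ Y) one) Z Z' (h : hom Z Z') :
  pairZ u Z' ∘ (X ◁ (Y ◁ h)) = h ∘ pairZ u Z.
Proof. by rewrite !pairZE -compA pad_nat !compA lunit_nat. Qed.

Lemma copairZ_nat X Y (u : hom one (X ⊗ Y)) Z Z' (h : hom Z Z') :
  copairZ u Z' ∘ h = (X ◁ (Y ◁ h)) ∘ copairZ u Z.
Proof.
by rewrite !copairZE -!compA lunitV_nat (ra2 (xchg _ _)) -!compA (ra2 (assoc_wl _ _ _)) -!compA.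
Qed.

(** The zigzag composite for an arbitrary copairing u and pairing e. It is
    the identity for a coevaluation and its evaluation. Keeping u and e
    independent makes the same lemma serve for the mate of a pairing and for
    comparing an arbitrary 1 -> X ⊗ X^* with the coevaluation. *)
Definition snake X Y (u : hom one (X ⊗ Y)) (e : hom (Y ⊗ X) one) : hom X X :=
  runit X ∘ (idm X ⊠ e) ∘ assoc X Y X ∘ (u ⊠ idm X) ∘ lunitV X.

Definition snake' A X Y (u : hom one (X ⊗ Y)) (e : hom (A ⊗ X) one) : hom A Y :=
  lunit Y ∘ (e ⊠ idm Y) ∘ assocV A X Y ∘ (idm A ⊠ u) ∘ runitV A.

Lemma pentagon_l W X Y Z :
  assocV W (X ⊗ Y) Z ∘ ((W ◁ assocV X Y Z) ∘ (assoc W X (Y ⊗ Z) ∘ assoc (W ⊗ X) Y Z)) =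
  assoc W X Y ▷ Z.
Proof.
rewrite pentagon -!compA (ra2 (esym (wl_comp _ _ _))) assocVK tensm_id compIm.
by rewrite (ra2 (assocVK _ _ _)) compIm.
Qed.

(** With snakeZ' this is the only place where associators and unit
    constraints meet duality: from here on zigzags cancel as in a strict
    category. *)
Lemma snakeZ X Y (u : hom one (X ⊗ Y)) (e : hom (Y ⊗ X) one) Z :
  (X ◁ pairZ e Z) ∘ copairZ u (X ⊗ Z) = snake u e ▷ Z.
Proof.
rewrite !pairZE !padE !copairZE /snake !wl_comp !wr_comp -!compA.
rewrite lunitV_tens triangleV -!compA (ra2 (esym (assoc_wr _ _ _))) -!compA.
congr (_ ∘ _); rewrite (ra2 (assocV_wm _ _ _)) -!compA; congr (_ ∘ _).
by rewrite (ra4 (pentagon_l _ _ _ _)).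
Qed.

Lemma pentagon_lV W X Y Z :
  assoc W (X ⊗ Y) Z ∘ ((assoc W X Y ▷ Z) ∘ (assocV (W ⊗ X) Y Z ∘ assocV W X (Y ⊗ Z))) =
  W ◁ assocV X Y Z.
Proof.
rewrite -pentagon_V (ra2 (esym (wr_comp _ _ _))) assocKV tensm_id compIm.
by rewrite (ra2 (assocKV _ _ _)) compIm.
Qed.

Lemma runitV_l X Y : (X ◁ lunitV Y) = assoc X one Y ∘ (runitV X ▷ Y).
Proof.
apply: (iso_injl (tensm_iso (idm_iso X) (lunit_iso Y))).
by rewrite -wl_comp lunitKV tensm_id compA triangle -wr_comp runitKV tensm_id.
Qed.

Lemma snakeZ' A X Y (u : hom one (X ⊗ Y)) (e : hom (A ⊗ X) one) Z :
  pairZ e (Y ⊗ Z) ∘ (A ◁ copairZ u Z) = snake' u e ▷ Z.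
Proof.
rewrite !pairZE !padE !copairZE /snake' !wl_comp !wr_comp -!compA.
rewrite -(lunit_tens Y Z) runitV_l -!compA; congr (_ ∘ _).
rewrite (ra2 (assoc_wr _ _ _)) -!compA; congr (_ ∘ _).
rewrite (ra2 (esym (assoc_wm _ _ _))) -!compA.
have e1 : assocV A X (Y ⊗ Z) ∘ ((A ◁ assoc X Y Z) ∘ assoc A (X ⊗ Y) Z) =
   assoc (A ⊗ X) Y Z ∘ (assocV A X Y ▷ Z).
  by rewrite compA pentagon_m -!compA assocVK compmI.
by rewrite (ra3 e1) -!compA.
Qed.

Lemma pairZ_l X' X Y (e : hom (X ⊗ Y) one) (h : hom X' X) Z :
  pairZ e Z ∘ (h ▷ (Y ⊗ Z)) = pairZ (e ∘ (h ▷ Y)) Z.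
Proof. by rewrite !pairZE !padE -!compA assocV_wr wr_comp -!compA. Qed.

Lemma pairZ_r X Y' Y (e : hom (X ⊗ Y) one) (h : hom Y' Y) Z :
  pairZ e Z ∘ (X ◁ (h ▷ Z)) = pairZ (e ∘ (X ◁ h)) Z.
Proof. by rewrite !pairZE !padE -!compA assocV_wm wr_comp -!compA. Qed.

(** The mate of nest (ev X) (ev Y) is the canonical isomorphism from Y^* ⊗
    X^* to the dual of X ⊗ Y. *)
Definition nest X X' Y Y' (eX : hom (X' ⊗ X) one) (eY : hom (Y' ⊗ Y) one) :
    hom ((Y' ⊗ X') ⊗ (X ⊗ Y)) one :=
  eY ∘ (Y' ◁ (lunit Y ∘ (eX ▷ Y) ∘ assocV X' X Y)) ∘ assoc Y' X' (X ⊗ Y).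

Lemma nestZ X X' Y Y' (eX : hom (X' ⊗ X) one) (eY : hom (Y' ⊗ Y) one) Z :
  pairZ (nest eX eY) Z ∘ (((Y' ⊗ X') ◁ assocV X Y Z) ∘ assocV Y' X' (X ⊗ (Y ⊗ Z))) =
  pairZ eY Z ∘ (Y' ◁ pairZ eX (Y ⊗ Z)).
Proof.
rewrite !pairZE !padE /nest !wr_comp -!compA; congr (_ ∘ (_ ∘ _)).
have e1 : (assoc Y' X' (X ⊗ Y) ▷ Z) ∘ (assocV (Y' ⊗ X') (X ⊗ Y) Z ∘
    (((Y' ⊗ X') ◁ assocV X Y Z) ∘ assocV Y' X' (X ⊗ (Y ⊗ Z)))) =
    assocV Y' (X' ⊗ (X ⊗ Y)) Z ∘ ((Y' ◁ assocV X' (X ⊗ Y) Z) ∘ (Y' ◁ (X' ◁ assocV X Y Z))).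
  rewrite -assocV_wl -[Y' ◁ assocV _ (X ⊗ Y) Z]pentagon_lV.
  by rewrite -!compA (ra2 (assocVK _ _ _)) compIm.
rewrite e1 (ra2 (esym (assocV_wm _ _ _))) -!compA; congr (_ ∘ _).
rewrite -!wl_comp; congr (_ ◁ _).
rewrite !wr_comp -!compA pentagon_V -(lunit_tens Y Z) -!compA; congr (_ ∘ _).
rewrite (ra2 (assoc_wr _ _ _)) -!compA; congr (_ ∘ _).
by rewrite (ra2 (assocKV _ _ _)) compIm.
Qed.

Lemma copairZ1 X Y (u u' : hom one (X ⊗ Y)) : copairZ u one = copairZ u' one -> u = u'.
Proof.
rewrite !copairZE => /(iso_injl (assoc_iso _ _ _)) /(iso_injr (lunitV_iso _)); exact: wr1_inj.
Qed.

Lemma copairZ_scale X Y (u : hom one (X ⊗ Y)) c Z : copairZ (c *: u) Z = c *: copairZ u Z.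
Proof. by rewrite !copairZE wrZ compZl compZr. Qed.

End Monoidal.

(** * Braidings on right-nested words *)

Section Braided.
Variables (k : fieldType) (C : braidedFusionCat k).
Implicit Types V W X Y Z : C.

Definition braidZ X Y Z : hom (X ⊗ (Y ⊗ Z)) (Y ⊗ (X ⊗ Z)) :=
  locked (assoc Y X Z ∘ ((braid X Y ▷ Z) ∘ assocV X Y Z)).

Lemma braidZE X Y Z : braidZ X Y Z = assoc Y X Z ∘ ((braid X Y ▷ Z) ∘ assocV X Y Z).
Proof. by rewrite /braidZ -lock. Qed.

Lemma braidZ_iso X Y Z : is_iso (braidZ X Y Z).
Proof.
rewrite braidZE; apply: is_iso_comp (assoc_iso _ _ _) _; apply: is_iso_comp (assocV_iso _ _ _).
exact: tensm_iso (braid_iso _ _) (idm_iso _).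
Qed.

Lemma braidZ_nat_l X X' Y Z (f : hom X X') :
  braidZ X' Y Z ∘ (f ▷ (Y ⊗ Z)) = (Y ◁ (f ▷ Z)) ∘ braidZ X Y Z.
Proof.
rewrite !braidZE -!compA assocV_wr (ra2 (esym (wr_comp _ _ _))) braid_nat wr_comp.
by rewrite -!compA (ra2 (assoc_wm _ _ _)) -?compA.
Qed.

Lemma braidZ_nat_m X Y Y' Z (g : hom Y Y') :
  braidZ X Y' Z ∘ (X ◁ (g ▷ Z)) = (g ▷ (X ⊗ Z)) ∘ braidZ X Y Z.
Proof.
rewrite !braidZE -!compA assocV_wm (ra2 (esym (wr_comp _ _ _))) braid_nat wr_comp.
by rewrite -!compA (ra2 (assoc_wr _ _ _)) -?compA.
Qed.

Lemma braidZ_nat_r X Y Z Z' (h : hom Z Z') :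
  braidZ X Y Z' ∘ (X ◁ (Y ◁ h)) = (Y ◁ (X ◁ h)) ∘ braidZ X Y Z.
Proof.
by rewrite !braidZE -!compA assocV_wl (ra2 (xchg _ _)) -!compA (ra2 (assoc_wl _ _ _)) -?compA.
Qed.

(** The two hexagons become the rule that a strand crosses X ⊗ Y by crossing
    the factors one after the other. *)
Lemma braidZ_hexl X Y V Z :
  braidZ (X ⊗ Y) V Z ∘ assocV X Y (V ⊗ Z) =
  (V ◁ assocV X Y Z) ∘ (braidZ X V (Y ⊗ Z) ∘ (X ◁ braidZ Y V Z)).
Proof.
rewrite !braidZE !wl_comp -?compA.
have e1 : assocV X V (Y ⊗ Z) ∘ (X ◁ assoc V Y Z) =
   assoc (X ⊗ V) Y Z ∘ ((assocV X V Y ▷ Z) ∘ assocV X (V ⊗ Y) Z).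
  exact: pentagon_m.
rewrite (ra2 e1) -!compA (ra2 (assocV_wm _ _ _)) -?compA.
rewrite (ra2 (esym (assoc_wr _ _ _))) -?compA.
have e3 : ((braid X V ▷ Y) ▷ Z) ∘ ((assocV X V Y ▷ Z) ∘ ((X ◁ braid Y V) ▷ Z)) =
    (assocV V X Y ▷ Z) ∘ ((braid (X ⊗ Y) V ▷ Z) ∘ (assocV X Y V ▷ Z)).
  by rewrite -!wr_comp; congr (_ ▷ Z); rewrite !compA hexagon2.
rewrite (ra3 e3) -!compA pentagon_V.
have e2 : (V ◁ assocV X Y Z) ∘ (assoc V X (Y ⊗ Z) ∘
    (assoc (V ⊗ X) Y Z ∘ (assocV V X Y ▷ Z))) = assoc V (X ⊗ Y) Z.
  by rewrite pentagon_r compA -wl_comp assocVK tensm_id compIm.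
by rewrite (ra4 e2).
Qed.

Lemma braidZ_hexr X Y V Z :
  braidZ V (X ⊗ Y) Z ∘ (V ◁ assocV X Y Z) =
  assocV X Y (V ⊗ Z) ∘ ((X ◁ braidZ V Y Z) ∘ braidZ V X (Y ⊗ Z)).
Proof.
rewrite !braidZE !wl_comp -?compA.
have e1 : (X ◁ assocV V Y Z) ∘ assoc X V (Y ⊗ Z) =
    assoc X (V ⊗ Y) Z ∘ ((assoc X V Y ▷ Z) ∘ assocV (X ⊗ V) Y Z).
  by rewrite -pentagon_lV -!compA assocVK compmI.
rewrite (ra2 e1) -?compA.
rewrite (ra2 (esym (assoc_wm _ _ _))) -!compA (ra2 (assocV_wr _ _ _)) -?compA.
have e2 : assocV X Y (V ⊗ Z) ∘ ((X ◁ assoc Y V Z) ∘ assoc X (Y ⊗ V) Z) =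
    assoc (X ⊗ Y) V Z ∘ (assocV X Y V ▷ Z).
  by rewrite compA pentagon_m -!compA assocVK compmI.
rewrite (ra3 e2) -!compA -pentagon_V.
have e3 : (assocV X Y V ▷ Z) ∘ (((X ◁ braid V Y) ▷ Z) ∘ ((assoc X V Y ▷ Z) ∘
    (((braid V X ▷ Y) ▷ Z) ∘ (assocV V X Y ▷ Z)))) = braid V (X ⊗ Y) ▷ Z.
  rewrite -!wr_comp; congr (_ ▷ Z).
  apply: (iso_injl (assoc_iso _ _ _)); apply: (iso_injr (assoc_iso _ _ _)) => /=.
  rewrite hexagon1 -!compA (ra2 (assocKV _ _ _)) compIm.
  by rewrite assocVK compmI !compA.
by rewrite -(ra2 e3) -?compA.
Qed.

Lemma lunit_one X : lunit ((one : C) ⊗ X) = (one : C) ◁ lunit X.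
Proof.
by apply: (iso_injl (lunit_iso X)); rewrite lunit_nat.
Qed.

(** The hexagon for 1 ⊗ 1 shows that B, which removes the unit after the
    crossing, satisfies B ∘ (1 ◁ B) = B ∘ lunit; as B is invertible, it is
    the unit constraint. *)
Lemma braidZ_one_l V Z : (V ◁ lunit Z) ∘ braidZ one V Z = lunit (V ⊗ Z).
Proof.
have [B defB] : exists B, B = (V ◁ lunit Z) ∘ braidZ one V Z by eexists.
rewrite -defB; have B_iso : is_iso B.
  rewrite defB; exact: is_iso_comp (tensm_iso (idm_iso _) (lunit_iso _)) (braidZ_iso _ _ _).
apply: wl1_inj; apply: (iso_injl B_iso); rewrite -lunit_one.
have <- : (lunit one ▷ (V ⊗ Z)) ∘ assocV one one (V ⊗ Z) = lunit (one ⊗ (V ⊗ Z)).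
  by rewrite -lunit_tens -!compA assocKV compmI.
rewrite {3}defB -!compA (ra2 (braidZ_nat_l _ _ _)) -!compA braidZ_hexl.
have key : (V ◁ (lunit one ▷ Z)) ∘ (V ◁ assocV one one Z) = V ◁ (one ◁ lunit Z).
  by rewrite -wl_comp -(lunit_tens one Z) -!compA assocKV compmI lunit_one.
rewrite (ra2 key) (ra2 (esym (braidZ_nat_r _ _ _))) -!compA -wl_comp -defB.
by rewrite defB -?compA.
Qed.

Lemma braidZ_one_r V Z : lunit (V ⊗ Z) ∘ braidZ V one Z = V ◁ lunit Z.
Proof.
have [B defB] : exists B, B = lunit (V ⊗ Z) ∘ braidZ V one Z by eexists.
rewrite -defB; have B_iso : is_iso B
  by rewrite defB; exact: is_iso_comp (lunit_iso _) (braidZ_iso _ _ _).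
have key : (V ◁ (lunit one ▷ Z)) ∘ (V ◁ assocV one one Z) = V ◁ (one ◁ lunit Z).
  by rewrite -wl_comp -(lunit_tens one Z) -!compA assocKV compmI lunit_one.
have e1 : (lunit one ▷ (V ⊗ Z)) ∘ assocV one one (V ⊗ Z) = one ◁ lunit (V ⊗ Z).
  by rewrite -lunit_one -lunit_tens -!compA assocKV compmI.
have e2 : (one ◁ B) ∘ braidZ V one (one ⊗ Z) = braidZ V one Z ∘ (V ◁ (one ◁ lunit Z)).
  by rewrite -key (ra2 (braidZ_nat_m _ _ _)) -!compA braidZ_hexr (ra2 e1) defB wl_comp -?compA.
have e3 : lunit (V ⊗ (one ⊗ Z)) ∘ braidZ V one (one ⊗ Z) = V ◁ (one ◁ lunit Z).
  by apply: (iso_injl B_iso); rewrite compA -lunit_nat -compA e2 compA -defB.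
apply: (iso_injr (tensm_iso (idm_iso V) (tensm_iso (idm_iso one) (lunit_iso Z)))).
by rewrite /= defB -compA braidZ_nat_r compA lunit_nat -compA e3.
Qed.

(** Naturality in string-diagram form: a strand V slides across a vertex u,
    crossing either the output of u or its two inputs. The variants below
    treat vertices that end or start at the unit, where one of the two sides
    has no crossing. *)
Lemma pad_brl X Y W (u : hom (X ⊗ Y) W) V Z :
  braidZ W V Z ∘ pad u (V ⊗ Z) = (V ◁ pad u Z) ∘ (braidZ X V (Y ⊗ Z) ∘ (X ◁ braidZ Y V Z)).
Proof.
by rewrite !padE (ra2 (braidZ_nat_l _ _ _)) -!compA braidZ_hexl wl_comp -?compA.
Qed.

Lemma pad_brr X Y W (u : hom (X ⊗ Y) W) V Z :
  braidZ V W Z ∘ (V ◁ pad u Z) = pad u (V ⊗ Z) ∘ ((X ◁ braidZ V Y Z) ∘ braidZ V X (Y ⊗ Z)).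
Proof.
by rewrite !padE wl_comp (ra2 (braidZ_nat_m _ _ _)) -!compA braidZ_hexr -?compA.
Qed.

Lemma pairZ_brl X Y (e : hom (X ⊗ Y) one) V Z :
  (V ◁ pairZ e Z) ∘ (braidZ X V (Y ⊗ Z) ∘ (X ◁ braidZ Y V Z)) = pairZ e (V ⊗ Z).
Proof.
by rewrite !pairZE wl_comp -!compA -pad_brl (ra2 (braidZ_one_l _ _)).
Qed.

Lemma pairZ_brr X Y (e : hom (X ⊗ Y) one) V Z :
  pairZ e (V ⊗ Z) ∘ ((X ◁ braidZ V Y Z) ∘ braidZ V X (Y ⊗ Z)) = V ◁ pairZ e Z.
Proof.
by rewrite !pairZE wl_comp -!compA -pad_brr (ra2 (braidZ_one_r _ _)).
Qed.

Lemma braidZ_one_rV V Z : braidZ V one Z ∘ (V ◁ lunitV Z) = lunitV (V ⊗ Z).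
Proof.
apply: (iso_injl (lunit_iso _)).
by rewrite compA braidZ_one_r lunitKV -wl_comp lunitKV tensm_id.
Qed.

Lemma copairZ_brr X Y (u : hom one (X ⊗ Y)) V Z :
  (X ◁ braidZ V Y Z) ∘ (braidZ V X (Y ⊗ Z) ∘ (V ◁ copairZ u Z)) = copairZ u (V ⊗ Z).
Proof.
apply: (iso_injl (assocV_iso _ _ _)).
rewrite !copairZE !wl_comp.
rewrite [(X ◁ _) ∘ _]compA compA -braidZ_hexr -?compA.
rewrite (ra2 (esym (wl_comp _ _ _))) assocVK tensm_id compIm.
by rewrite (ra2 (braidZ_nat_m _ _ _)) -!compA braidZ_one_rV (ra2 (assocVK _ _ _)) compIm.
Qed.

End Braided.

(** * Monodromy, duals and strands around a loop *)

Section Rigid.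
Variables (k : fieldType) (C : fusionCat k).
Implicit Types V W X Y Z : C.

Definition evZ X Z := pairZ (ev X) Z.
Definition coevZ X Z := copairZ (coev X) Z.

Lemma zigzag X Z : (X ◁ evZ X Z) ∘ coevZ X (X ⊗ Z) = idm _.
Proof. by rewrite snakeZ /snake (proj1 (dualP X)) tensm_id. Qed.

Lemma zigzag' X Z : evZ X (dual X ⊗ Z) ∘ (dual X ◁ coevZ X Z) = idm _.
Proof. by rewrite snakeZ' /snake' (proj2 (dualP X)) tensm_id. Qed.

Lemma evZ_nat X Z Z' (h : hom Z Z') :
  evZ X Z' ∘ (dual X ◁ (X ◁ h)) = h ∘ evZ X Z.
Proof. exact: pairZ_nat. Qed.

Lemma coevZ_nat X Z Z' (h : hom Z Z') :
  coevZ X Z' ∘ h = (X ◁ (dual X ◁ h)) ∘ coevZ X Z.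
Proof. exact: copairZ_nat. Qed.

(** Tensoring with a on the left has the left adjoint given by the dual of
    a, so it preserves monomorphisms. A morphism w into a ⊗ Y is recovered
    from its transpose. *)
Lemma wl_mono a X Y (i : hom Y X) : mono i -> mono (a ◁ i).
Proof.
move=> iM W u v iu_iv.
have recover (w : hom W (a ⊗ Y)) : w = (a ◁ (evZ a Y ∘ (dual a ◁ w))) ∘ coevZ a W.
  by rewrite wl_comp -compA -coevZ_nat (ra2 (zigzag _ _)) compIm.
rewrite (recover u) (recover v); congr (_ ◁ _ ∘ _); apply: iM.
by rewrite !(ra2 (esym (evZ_nat _ _))) -!compA -!wl_comp iu_iv.
Qed.

End Rigid.

Section Monodromy.
Variables (k : fieldType) (C : braidedFusionCat k).
Implicit Types a V W X Y Z : C.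

Definition monodromy a X (b : k) := braid X a ∘ braid a X = b *: idm (a ⊗ X).

Lemma braidZ_braidZ a X Z : braidZ X a Z ∘ braidZ a X Z =
  assoc a X Z ∘ (((braid X a ∘ braid a X) ▷ Z) ∘ assocV a X Z).
Proof.
by rewrite !braidZE -!compA (ra2 (assocVK _ _ _)) compIm (ra2 (esym (wr_comp _ _ _))).
Qed.

Lemma monodromyZ a X b Z : monodromy a X b -> braidZ X a Z ∘ braidZ a X Z = b *: idm _.
Proof.
by rewrite /monodromy braidZ_braidZ => ->; rewrite wrZidm compZl compIm compZr assocKV.
Qed.

Lemma monodromy_br1 a X b : braidZ X a one ∘ braidZ a X one = b *: idm _ -> monodromy a X b.
Proof.
rewrite braidZ_braidZ /monodromy => e; apply: wr1_inj; rewrite wrZidm.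
apply: (iso_injl (assoc_iso _ _ _)); apply: (iso_injr (assocV_iso _ _ _)).
by rewrite /= -!compA e compZl compIm compZr assocKV.
Qed.

Lemma monodromy_sym a X b : monodromy a X b -> monodromy X a b.
Proof.
rewrite /monodromy => e; apply: (iso_injr (braid_iso a X)).
by rewrite /= -compA e compZl compZr compIm compmI.
Qed.

Lemma monodromy_hom a X Y (f : hom X Y) b c :
  monodromy a X b -> monodromy a Y c -> b *: (a ◁ f) = c *: (a ◁ f).
Proof.
move=> aX aY; rewrite -[a ◁ f in LHS]compmI -compZr -aX.
rewrite -[a ◁ f in RHS]compIm -compZl -aY.
by rewrite -[RHS]compA braid_nat !compA braid_nat.
Qed.

Lemma monodromy_sub a X Y (i : hom Y X) b : mono i -> monodromy a X b -> monodromy a Y b.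
Proof.
move=> iM aX; apply: (wl_mono iM (a := a)).
rewrite compA -braid_nat -compA -braid_nat compA aX.
by rewrite compZl compIm compZr compmI.
Qed.

Lemma monodromy_dsum a n (F : 'I_n -> C) S b :
  is_dsum F S -> (forall i, monodromy a (F i) b) -> monodromy a S b.
Proof.
move=> [inj [prj [_ _ sum1]]] aF; rewrite /monodromy.
have -> : idm (a ⊗ S) = \sum_i ((a ◁ inj i) ∘ (a ◁ prj i)).
  by rewrite -tensm_id -sum1 wl_sum; apply: eq_bigr => i _; rewrite wl_comp.
rewrite -[LHS]compmI -[idm (a ⊗ S)]tensm_id -sum1 wl_sum comp_sumr scaler_sumr.
apply: eq_bigr => i _; rewrite wl_comp.
rewrite compA -[_ ∘ (a ◁ inj i)]compA braid_nat compA braid_nat -[_ ∘ braid a (F i)]compA.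
by rewrite aF !compZr compZl compmI.
Qed.

Lemma monodromy_isom a X Y b : isom X Y -> monodromy a X b -> monodromy a Y b.
Proof. by move=> /isom_sym [f /iso_mono fM]; apply: monodromy_sub fM. Qed.

Lemma monodromy_isoml a a' X b : isom a a' -> monodromy a X b -> monodromy a' X b.
Proof.
by move=> aa' aX; apply: monodromy_sym; apply: monodromy_isom aa' _; apply: monodromy_sym.
Qed.

Lemma monodromy_tens a X Y b c :
  monodromy a X b -> monodromy a Y c -> monodromy a (X ⊗ Y) (b * c).
Proof.
move=> aX aY; apply: monodromy_br1; set Z := (one : C).
apply: (iso_injr (tensm_iso (idm_iso a) (assocV_iso X Y Z))).
rewrite /= -compA braidZ_hexr (ra2 (braidZ_hexl _ _ _ _)) -!compA.
rewrite [(X ◁ braidZ Y a Z) ∘ _]compA -wl_comp (monodromyZ _ aY) wlZidm compZl compIm.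
by rewrite !compZr (monodromyZ _ aX) !compZl !compZr compmI compIm scalerA mulrC.
Qed.

Lemma monodromy_tensl a a' X b c :
  monodromy a X b -> monodromy a' X c -> monodromy (a ⊗ a') X (b * c).
Proof.
by move=> aX a'X; apply: monodromy_sym; apply: monodromy_tens; apply: monodromy_sym.
Qed.

(** The evaluation ends at the unit, past which a moves freely, so moving a
    around X^* and then around X has no effect. *)
Lemma monodromy_dual a X b : b != 0 -> monodromy a X b -> monodromy a (dual X) b^-1.
Proof.
move=> b_neq0 aX; apply: monodromy_br1; set Z := (one : C).
have brbr_nat Z1 Z2 (h : hom Z1 Z2) :
    (braidZ (dual X) a Z2 ∘ braidZ a (dual X) Z2) ∘ (a ◁ (dual X ◁ h)) =
    (a ◁ (dual X ◁ h)) ∘ (braidZ (dual X) a Z1 ∘ braidZ a (dual X) Z1).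
  by rewrite -compA braidZ_nat_r (ra2 (braidZ_nat_r _ _ _)) -!compA.
have key Z' : (a ◁ evZ X Z') ∘ (braidZ (dual X) a _ ∘ braidZ a (dual X) _) =
    b^-1 *: (a ◁ evZ X Z').
  rewrite -[in RHS]pairZ_brr -pairZ_brl.
  rewrite -!compA [(dual X ◁ braidZ X a _) ∘ _]compA -wl_comp (monodromyZ _ aX).
  by rewrite wlZidm compZl compIm !compZr scalerA mulVf ?scale1r.
have zz : (a ◁ evZ X (dual X ⊗ Z)) ∘ (a ◁ (dual X ◁ coevZ X Z)) = idm _.
  by rewrite -wl_comp zigzag' tensm_id.
rewrite -[LHS]compIm -{1}zz -compA -brbr_nat compA key.
by rewrite compZl zz.
Qed.

(** For an invertible object a the self-braiding is a scalar s. On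
    isomorphism classes of invertible objects it is the quadratic form whose
    polarization is the monodromy. *)
Definition selfbr a (s : k) := braid a a = s *: idm (a ⊗ a).

Lemma selfbrZ a s Z : selfbr a s -> braidZ a a Z = s *: idm _.
Proof. by rewrite /selfbr braidZE => ->; rewrite wrZidm compZl compIm compZr assocKV. Qed.

Lemma selfbr_br1 a s : braidZ a a one = s *: idm _ -> selfbr a s.
Proof.
rewrite braidZE /selfbr => e; apply: wr1_inj; rewrite wrZidm.
apply: (iso_injl (assoc_iso _ _ _)); apply: (iso_injr (assocV_iso _ _ _)).
by rewrite /= -!compA e compZl compIm compZr assocKV.
Qed.

Lemma selfbr_isom a a' s : isom a a' -> selfbr a s -> selfbr a' s.
Proof.
move=> [f f_iso]; rewrite /selfbr => e.
apply: (iso_injr (tensm_iso f_iso f_iso)).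
by rewrite /= braid_nat e compZl compZr compIm compmI.
Qed.

(** Two applications of the hexagons split the crossing into four: one for
    each factor with itself, and two that make up a double braiding. *)
Lemma selfbr_tens a a' s s' b : selfbr a s -> selfbr a' s' -> monodromy a a' b ->
  selfbr (a ⊗ a') (s * s' * b).
Proof.
move=> aa a'a' ab; apply: selfbr_br1; set Z := (one : C).
apply: (iso_injr (tensm_iso (idm_iso (a ⊗ a')) (assocV_iso a a' Z))).
apply: (iso_injr (assocV_iso a a' _)).
rewrite /= braidZ_hexr -!compA braidZ_hexl.
rewrite [(a ◁ braidZ (a ⊗ a') a' Z) ∘ _]compA -wl_comp braidZ_hexl.
rewrite !wl_comp (selfbrZ _ a'a') (selfbrZ _ aa) !wlZidm.
rewrite !(compZl, compZr) !compIm.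
rewrite compmI -!compA -[(a ◁ braidZ a a' _) ∘ _]wl_comp (monodromyZ _ (monodromy_sym ab)).
rewrite wlZidm !compZr compmI assocV_wl !scalerA; congr (_ *: _).
by rewrite [s' * s]mulrC.
Qed.

(** X and its dual are created, crossed and annihilated. Up to conventions
    this is the twist of X times its dimension; no pivotal structure enters. *)
Definition loop X Z : hom Z Z := evZ X Z ∘ (braidZ X (dual X) Z ∘ coevZ X Z).

Section Slide.
Variables (g X : C) (f : hom (g ⊗ X) X) (f' : hom X (g ⊗ X)).
Hypothesis ff' : inverse_pair f f'.

(* F absorbs a strand g into X, and G emits it. *)
Let F Z := pad f Z.
Let G Z : hom (X ⊗ Z) (g ⊗ (X ⊗ Z)) := locked (assoc g X Z ∘ (f' ▷ Z)).

Let GE Z : G Z = assoc g X Z ∘ (f' ▷ Z).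
Proof. by rewrite /G -lock. Qed.

Let FG Z : F Z ∘ G Z = idm _.
Proof.
rewrite /F GE padE -compA (ra2 (assocVK _ _ _)) compIm -wr_comp.
by rewrite (proj2 ff') tensm_id.
Qed.

Let GF Z : G Z ∘ F Z = idm _.
Proof.
rewrite /F GE padE -compA (ra2 (esym (wr_comp _ _ _))) (proj1 ff') tensm_id.
by rewrite compIm assocKV.
Qed.

Let G_nat Z Z' (h : hom Z Z') : G Z' ∘ (X ◁ h) = (g ◁ (X ◁ h)) ∘ G Z.
Proof. by rewrite !GE -compA xchg (ra2 (assoc_wl _ _ _)) -compA. Qed.

Let F_nat Z Z' (h : hom Z Z') : F Z' ∘ (g ◁ (X ◁ h)) = (X ◁ h) ∘ F Z.
Proof. exact: pad_nat. Qed.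

(* H absorbs g into the left strand of a new coevaluation. *)
Let H Z : hom (g ⊗ Z) (X ⊗ (dual X ⊗ Z)) :=
  locked (F (dual X ⊗ Z) ∘ (g ◁ coevZ X Z)).

Let HE Z : H Z = F (dual X ⊗ Z) ∘ (g ◁ coevZ X Z).
Proof. by rewrite /H -lock. Qed.

(* T is the transpose of F: it absorbs g into the dual strand. *)
Let T Z : hom (dual X ⊗ (g ⊗ Z)) (dual X ⊗ Z) :=
  locked (evZ X (dual X ⊗ Z) ∘ (dual X ◁ H Z)).

Let TE Z : T Z = evZ X (dual X ⊗ Z) ∘ (dual X ◁ H Z).
Proof. by rewrite /T -lock. Qed.

Let ev_T Z : evZ X Z ∘ T (X ⊗ Z) = evZ X Z ∘ (dual X ◁ F Z).
Proof.
rewrite TE HE (ra2 (esym (evZ_nat _ _))) -compA -wl_comp.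
by rewrite (ra2 (esym (F_nat _))) -compA -wl_comp zigzag tensm_id compmI.
Qed.

Let T_coev Z : (X ◁ T Z) ∘ coevZ X (g ⊗ Z) = H Z.
Proof.
by rewrite TE wl_comp -compA -coevZ_nat (ra2 (zigzag _ _)) compIm.
Qed.

Let H_br V Z : (X ◁ braidZ V (dual X) Z) ∘ (braidZ V X (dual X ⊗ Z) ∘ (V ◁ H Z)) =
  H (V ⊗ Z) ∘ braidZ V g Z.
Proof.
rewrite !HE wl_comp (ra2 (pad_brr _ _ _)) -!compA braidZ_nat_r.
rewrite (ra2 (esym (F_nat _))) -!compA; congr (_ ∘ _).
by rewrite !(ra2 (esym (wl_comp _ _ _))) -!compA copairZ_brr.
Qed.

Let T_br V Z : braidZ V (dual X) Z ∘ (V ◁ T Z) =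
  T (V ⊗ Z) ∘ ((dual X ◁ braidZ V g Z) ∘ braidZ V (dual X) (g ⊗ Z)).
Proof.
rewrite !TE wl_comp -[V ◁ evZ _ _]pairZ_brr.
rewrite -!compA (ra2 (esym (evZ_nat _ _))) -!compA; congr (_ ∘ _).
rewrite braidZ_nat_r !(ra2 (esym (wl_comp _ _ _))) -!compA; congr (_ ∘ _).
by congr (_ ◁ _); apply: H_br.
Qed.

(** A vertex f : g ⊗ X -> X is invertible, so a strand g can be emitted from
    the loop at one point and absorbed at another. Let the point of
    absorption travel once around the loop: transpose f across the
    coevaluation, take it through the crossing, and transpose it back across
    the evaluation. The strand g then crosses itself once, which costs
    nothing when its self- braiding is trivial, and it winds once around X,
    which costs the monodromy b. *)
Lemma loop_slide b Z : selfbr g 1 -> monodromy g X b ->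
  g ◁ loop X Z = b *: loop X (g ⊗ Z).
Proof.
move=> gg gX.
have GH Z' : G (dual X ⊗ Z') ∘ H Z' = g ◁ coevZ X Z'.
  by rewrite HE (ra2 (GF _)) compIm.
(* Write g ◁ coevZ as G after H, replace H by T after a coevaluation, and let
   T pass through the crossing and then through the evaluation. *)
have step1 : g ◁ loop X Z = (g ◁ evZ X Z) ∘ ((g ◁ (dual X ◁ (F Z ∘ braidZ X g Z))) ∘
    ((g ◁ braidZ X (dual X) (g ⊗ Z)) ∘ (G _ ∘ coevZ X (g ⊗ Z)))).
  rewrite /loop compA wl_comp -GH -T_coev (ra2 (G_nat _)) -!compA.
  rewrite !(ra2 (esym (wl_comp _ _ _))) -!compA T_br (ra2 (ev_T _)).
  congr (g ◁ _ ∘ _); by rewrite wl_comp -!compA.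
(* Where absorption meets emission, g has crossed itself once and X twice. *)
have brF : braidZ g X Z ∘ ((g ◁ (F Z ∘ braidZ X g Z)) ∘ G (g ⊗ Z)) = b *: idm _.
  have e1 : g ◁ (F Z ∘ braidZ X g Z) = braidZ X g Z ∘ F (g ⊗ Z).
    by rewrite pad_brl (selfbrZ _ gg) scale1r compIm wl_comp.
  by rewrite e1 -compA FG compmI (monodromyZ _ (monodromy_sym gX)).
have GF_br Z' : braidZ g (dual X) (X ⊗ Z') ∘ ((g ◁ braidZ X (dual X) Z') ∘ G (dual X ⊗ Z')) =
    (dual X ◁ G Z') ∘ braidZ X (dual X) Z'.
  rewrite -[LHS]compIm -tensm_id -(GF Z') wl_comp -compA.
  have e1 := pad_brl f (dual X) Z'.
  rewrite [braidZ g _ _ ∘ _]compA [(dual X ◁ F Z') ∘ _]compA -e1 -compA.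
  by rewrite FG compmI.
rewrite step1 -[g ◁ evZ _ _]pairZ_brr -!compA (ra2 (braidZ_nat_r _ _ _)) -!compA.
rewrite [braidZ g _ _ ∘ _]compA -compA (ra3 (GF_br _)).
rewrite (ra2 (esym (wl_comp _ _ _))) -!compA (ra2 (esym (wl_comp _ _ _))) -!compA.
by rewrite brF wlZidm compZl compIm compZr.
Qed.
End Slide.

Lemma loopE X Z :
  loop X Z = lunit Z ∘ (((ev X ∘ (braid X (dual X) ∘ coev X)) ▷ Z) ∘ lunitV Z).
Proof.
rewrite /loop /evZ /coevZ pairZE padE copairZE braidZE -!compA.
rewrite (ra2 (assocVK _ _ _)) compIm (ra2 (assocVK _ _ _)) compIm !wr_comp.
by rewrite -!compA.
Qed.

End Monodromy.

Section SimpleRigid.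
Variables (k : closedFieldType) (C : fusionCat k).
Implicit Types X Y Z : C.

Lemma fus_simple_end X (f : hom X X) : simple_obj X -> exists c, f = c *: idm X.
Proof. exact/simple_end/fus_abelian. Qed.

Lemma one_nonzero : nonzero (one : C).
Proof.
move=> id0; have := end_one C; suff -> : fullv = 0%VS :> {vspace hom (one : C) one}.
  by rewrite dimv0.
by apply/eqP; rewrite -subv0; apply/subvP => f' _; rewrite -[f']compIm id0 comp0l mem0v.
Qed.

Lemma one_end (f : hom (one : C) one) : exists c, f = c *: idm one.
Proof. by apply: dim1_scalar; [exact: end_one|exact/eqP/one_nonzero]. Qed.

Lemma end1_simple X : (forall f : hom X X, exists c, f = c *: idm X) ->
  nonzero X -> simple_obj X.
Proof.
move=> endX X_neq0; have [n [F [Fs F_sum]]] := fus_semisimple X.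
by have [i /isom_sym XF] := simple_dsum1 endX X_neq0 Fs F_sum; apply: isom_simple XF (Fs i).
Qed.

Lemma one_simple : simple_obj (one : C).
Proof. exact: end1_simple one_end one_nonzero. Qed.

(** The zigzag of u with the evaluation is an endomorphism of X, hence a
    scalar, and the other zigzag turns this scalar back into a relation
    between u and the coevaluation. *)
Lemma hom1_coev X (u : hom one (X ⊗ dual X)) : simple_obj X -> exists c, u = c *: coev X.
Proof.
move=> Xs; have [c e] := fus_simple_end (snake u (ev X)) Xs.
exists c; apply: copairZ1; set Z := (one : C).
have -> : copairZ u Z = (X ◁ evZ X (dual X ⊗ Z)) ∘ ((X ◁ (dual X ◁ coevZ X Z)) ∘ copairZ u Z).
  by rewrite compA -wl_comp zigzag' tensm_id compIm.
by rewrite -copairZ_nat compA snakeZ e wrZidm compZl compIm copairZ_scale.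
Qed.

Lemma ev_neq0 X : nonzero X -> ev X <> 0.
Proof.
move=> X_neq0 ev0; apply: X_neq0; rewrite -(proj1 (dualP X)) ev0 wl0.
by rewrite comp0r !comp0l.
Qed.

(** The unit occurs in X ⊗ X^* only once, namely through the coevaluation,
    so a form that vanishes there vanishes on every summand. *)
Lemma form_coev X (e : hom (X ⊗ dual X) one) : simple_obj X -> e <> 0 -> e ∘ coev X <> 0.
Proof.
move=> Xs e_neq0 e_coev; apply: e_neq0.
have [n [F [Fs [inj [prj [_ _ sum1]]]]]] := fus_semisimple (X ⊗ dual X).
rewrite -[e]compmI -sum1 comp_sumr big1 // => i _.
rewrite compA; suff -> : e ∘ inj i = 0 by rewrite comp0l.
apply: contrapT => ei_neq0.
have [h [_ ih]] := simple_hom_iso (fus_abelian C) (Fs i) one_simple ei_neq0.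
have [c inj_h] := hom1_coev (inj i ∘ h) Xs.
by apply: one_nonzero; rewrite -ih -compA inj_h compZr e_coev scaler0.
Qed.

End SimpleRigid.

Section FixedMonodromy.
Variables (k : closedFieldType) (C : braidedFusionCat k).
Implicit Types X Y Z g : C.

(** The loop is a nonzero scalar t by form_coev, and sliding gives t = b t. *)
Lemma fixed_monodromy g X b : simple_obj g -> simple_obj X -> isom (g ⊗ X) X ->
  selfbr g 1 -> monodromy g X b -> b = 1.
Proof.
move=> [g_neq0 _] Xs [f [f' ff']] gg gX.
have [t tE] := one_end (ev X ∘ (braid X (dual X) ∘ coev X)).
have loopt Z : loop X Z = t *: idm Z.
  by rewrite loopE tE wrZidm compZl compZr compIm lunitKV.
have t_neq0 : t != 0.
  apply/eqP => t0; have e_neq0 : ev X ∘ braid X (dual X) <> 0.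
    move=> e0; apply: (ev_neq0 (proj1 Xs)).
    by apply: (iso_injr (braid_iso X (dual X))); rewrite /= e0 comp0l.
  by apply: (form_coev Xs e_neq0); rewrite -compA tE t0 scale0r.
have := loop_slide ff' one gg gX; rewrite !loopt wlZidm scalerA => e.
have g1_neq0 : idm (g ⊗ one) != 0.
  apply/eqP => g0; apply: g_neq0; apply: (iso_injr (runit_iso g)).
  by rewrite /= -[runit g]compmI g0 !comp0r.
move/eqP: e; rewrite -subr_eq0 -scalerBl scaler_eq0 (negbTE g1_neq0) orbF.
by rewrite subr_eq0 -{1}[t]mul1r => /eqP /(mulIf t_neq0) ->.
Qed.

End FixedMonodromy.

(** * Multiplicativity of pivotal dimensions *)

Section Trace.
Variables (k : closedFieldType) (C : fusionCat k).
Implicit Types A W X Y Z : C.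

Lemma mateZ A X (g : hom (A ⊗ X) one) Z :
  pairZ g (dual X ⊗ Z) ∘ (A ◁ coevZ X Z) = mate g ▷ Z.
Proof. exact: snakeZ'. Qed.

(** The defining property of the mate, in front of a spectator. *)
Lemma mate_ev A X (g : hom (A ⊗ X) one) Z :
  evZ X Z ∘ (mate g ▷ (X ⊗ Z)) = pairZ g Z.
Proof.
rewrite -mateZ compA -pairZ_nat -compA -wl_comp zigzag.
by rewrite tensm_id compmI.
Qed.

Lemma scalar_ofE c : scalar_of (c *: idm (one : C)) = c.
Proof.
have free1 : free [tuple idm (one : C)].
  by rewrite (_ : tval _ = [:: idm (one : C)]) // seq1_free; apply/eqP/one_nonzero.
have := coord_free ord0 ord0 free1; rewrite /scalar_of linearZ /= => ->.
by rewrite mulr1.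
Qed.

Variable a : forall X : C, hom X (dual (dual X)).

Definition cdim X := ptrace a (idm X).

Lemma ptrace_scale X c : ptrace a (c *: idm X) = c * cdim X.
Proof.
rewrite /cdim /ptrace compZr wrZ compZr compZl.
have [t ->] := one_end (ev (dual X) ∘ ((a X ∘ idm X) ▷ dual X) ∘ coev X).
by rewrite scalerA !scalar_ofE.
Qed.

Lemma ptraceZ X Z :
  evZ (dual X) Z ∘ ((a X ▷ (dual X ⊗ Z)) ∘ coevZ X Z) = cdim X *: idm Z.
Proof.
rewrite /cdim /ptrace compmI.
have [t e] := one_end (ev (dual X) ∘ (a X ▷ dual X) ∘ coev X).
rewrite e scalar_ofE compA pairZ_l /evZ /coevZ pairZE padE copairZE -!compA.
rewrite (ra2 (assocVK _ _ _)) compIm (ra2 (esym (wr_comp _ _ _))) e.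
by rewrite wrZidm compZl compIm compZr lunitKV.
Qed.

(** The copairing matching [nest (ev X) (ev Y)]. *)
Let ncoev X Y Z : hom Z ((X ⊗ Y) ⊗ ((dual Y ⊗ dual X) ⊗ Z)) :=
  locked (((X ⊗ Y) ◁ assocV (dual Y) (dual X) Z) ∘ (assocV X Y _ ∘
     ((X ◁ coevZ Y (dual X ⊗ Z)) ∘ coevZ X Z))).

Let ncoevE X Y Z : ncoev X Y Z = ((X ⊗ Y) ◁ assocV (dual Y) (dual X) Z) ∘ (assocV X Y _ ∘
     ((X ◁ coevZ Y (dual X ⊗ Z)) ∘ coevZ X Z)).
Proof. by rewrite /ncoev -lock. Qed.

Let ncoev_nat X Y Z Z' (h : hom Z Z') :
  ncoev X Y Z' ∘ h = ((X ⊗ Y) ◁ ((dual Y ⊗ dual X) ◁ h)) ∘ ncoev X Y Z.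
Proof.
rewrite !ncoevE -!compA coevZ_nat (ra2 (esym (wl_comp _ _ _))) coevZ_nat wl_comp -!compA.
rewrite (ra2 (assocV_wl _ _ _)) -!compA !(ra2 (esym (wl_comp _ _ _))).
by rewrite assocV_wl.
Qed.

Let g0 X Y := nest (ev X) (ev Y).

Let nest_zigzag X Y W : ((X ⊗ Y) ◁ pairZ (g0 X Y) W) ∘ ncoev X Y ((X ⊗ Y) ⊗ W) = idm _.
Proof.
apply: (iso_injr (assocV_iso X Y W)); rewrite /= compIm -compA ncoev_nat ncoevE.
rewrite !(ra2 (esym (wl_comp _ _ _))) -compA nestZ.
rewrite (ra2 (esym (assocV_wl _ _ _))) -!compA !(ra2 (esym (wl_comp _ _ _))).
rewrite [Y ◁ (_ ∘ _)]wl_comp -compA -coevZ_nat (ra2 (zigzag _ _)) compIm zigzag.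
by rewrite compmI.
Qed.

Let dual_tens_coev X Y Z :
  ((X ⊗ Y) ◁ (dual_tens X Y ▷ Z)) ∘ ncoev X Y Z = coevZ (X ⊗ Y) Z.
Proof.
rewrite /dual_tens -/(nest (ev X) (ev Y)) -mateZ wl_comp -compA -ncoev_nat compA.
by rewrite nest_zigzag compIm.
Qed.

(** The coevaluation of X ⊗ Y is the nested one up to dual_tens. Monoidality
    of the pivotal structure moves dual_tens to the other side, where it
    turns the evaluation into the nested one; then the inner loop gives the
    dimension of Y and the outer one that of X. *)
Lemma cdim_tens X Y : is_pivotal a -> cdim (X ⊗ Y) = cdim X * cdim Y.
Proof.
move=> [_ _ a_mon]; set Z := (one : C).
suff e : cdim (X ⊗ Y) *: idm Z = (cdim X * cdim Y) *: idm Z.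
  by rewrite -[LHS]scalar_ofE e scalar_ofE.
rewrite -ptraceZ -dual_tens_coev.
set E := dual Y ⊗ dual X; set D := dual (X ⊗ Y).
rewrite (ra2 (xchg _ _)) -compA (ra2 (pairZ_r _ _ _)) -mate_ev.
rewrite -/(dualm (dual_tens X Y)) -!compA (ra2 (esym (wr_comp _ _ _))) a_mon wr_comp.
rewrite /dual_tens -/(nest (ev (dual Y)) (ev (dual X))) -!compA (ra2 (mate_ev _ _)).
rewrite ncoevE (ra2 (xchg _ _)) -compA.
have e1 : ((a X ⊠ a Y) ▷ (dual Y ⊗ (dual X ⊗ Z))) ∘ assocV X Y (dual Y ⊗ (dual X ⊗ Z)) =
   assocV _ _ _ ∘ (a X ⊠ (a Y ▷ (dual Y ⊗ (dual X ⊗ Z)))) by rewrite assocV_nat.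
rewrite (ra2 e1) -!compA (ra3 (nestZ _ _ _)) -!compA.
rewrite (ra2 (esym (tensm_comp _ _ _ _))) compIm.
rewrite (ra2 (esym (tensm_comp _ _ _ _))) compmI -compA ptraceZ.
by rewrite tensm_lr wlZidm compZr compmI compZl compZr ptraceZ scalerA mulrC.
Qed.

End Trace.

(** * Invertible objects *)

Section Invertible.
Variables (k : closedFieldType) (C : fusionCat k).
Implicit Types a b X Y Z : C.

Lemma nonzero_dim_simple X Y : \dim {:hom X X} = \dim {:hom Y Y} ->
  simple_obj X -> nonzero Y -> simple_obj Y.
Proof.
move=> XY Xs Y_neq0; apply: end1_simple => // f.
apply: dim1_scalar; last by apply/eqP.
by rewrite -XY simple_dim1 //; apply: fus_abelian.
Qed.

Lemma invertible_one : invertible (one : C).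
Proof. by exists one; split; apply: isom_lunit. Qed.

Lemma invertible_isom X Y : isom X Y -> invertible X -> invertible Y.
Proof.
move=> /isom_sym YX [X' [XX' X'X]]; exists X'.
by split; [apply: isom_trans XX'|apply: isom_trans X'X];
   apply: isom_tens => //; apply: isom_refl.
Qed.

Lemma isom_cancel a b X : isom (b ⊗ a) one -> isom (b ⊗ (a ⊗ X)) X.
Proof.
move=> ba; apply: isom_trans (isom_sym (isom_assoc _ _ _)) _.
by apply: isom_trans (isom_lunit X); apply: isom_tens ba (isom_refl _).
Qed.

Lemma invertible_tens a b : invertible a -> invertible b -> invertible (a ⊗ b).
Proof.
have half x x' y y' : isom (x ⊗ x') (one : C) -> isom (y ⊗ y') (one : C) ->
    isom ((x ⊗ y) ⊗ (y' ⊗ x')) (one : C).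
  move=> xx yy; apply: isom_trans (isom_assoc _ _ _) _.
  by apply: isom_trans xx; apply: isom_tens (isom_refl _) _; apply: isom_cancel.
move=> [a' [aa' a'a]] [b' [bb' b'b]]; exists (b' ⊗ a').
by split; apply: half.
Qed.

(** The inverse b of a turns a ◁ f back into f, up to the natural
    isomorphism from b ⊗ (a ⊗ X) to X. *)
Lemma wl_inj a X Y (f g : hom X Y) : invertible a -> a ◁ f = a ◁ g -> f = g.
Proof.
move=> [b [_ [r r_iso]]] fg.
have N_iso : is_iso (pairZ r X).
  rewrite pairZE padE; apply: is_iso_comp (lunit_iso _) _.
  exact: is_iso_comp (tensm_iso r_iso (idm_iso _)) (assocV_iso _ _ _).
by apply: (iso_injr N_iso); rewrite /= -!pairZ_nat fg.
Qed.

(** Both a and its inverse act injectively on Hom spaces, and acting by both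
    in turn returns a Hom space of the original dimension. *)
Lemma invertible_dim a X Y : invertible a ->
  \dim {:hom (a ⊗ X) (a ⊗ Y)} = \dim {:hom X Y}.
Proof.
have le c Z Z' : invertible c -> (\dim {:hom Z Z'} <= \dim {:hom (c ⊗ Z) (c ⊗ Z')})%N.
  move=> c_inv; apply: (@dim_inj _ _ _ (fun f => c ◁ f)) => [x f g|f g].
    by rewrite wlD wlZ.
  exact: wl_inj.
move=> a_inv; have [b [ab ba]] := a_inv.
have b_inv : invertible b by exists a.
apply/eqP; rewrite eqn_leq le // andbT.
apply: leq_trans (le b _ _ b_inv) _; apply: isom_dim_le; exact: isom_cancel.
Qed.

Lemma invertible_nonzero a X : invertible a -> nonzero X -> nonzero (a ⊗ X).
Proof.
move=> a_inv X_neq0 aX0; apply: X_neq0; apply: (wl_inj a_inv).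
by rewrite tensm_id aX0 wl0.
Qed.

Lemma invertible_tens_simple a X : invertible a -> simple_obj X -> simple_obj (a ⊗ X).
Proof.
move=> a_inv Xs; apply: (nonzero_dim_simple (X := X)) => //.
  by rewrite invertible_dim.
by apply: invertible_nonzero => //; case: Xs.
Qed.

Lemma invertible_simple a : invertible a -> simple_obj a.
Proof.
move=> a_inv; apply: isom_simple (isom_runit a) _.
exact: invertible_tens_simple a_inv (one_simple C).
Qed.

Lemma invertible_isom_inj a X Y : invertible a -> isom (a ⊗ X) (a ⊗ Y) -> isom X Y.
Proof.
move=> [b [_ ba]] aXY.
apply: isom_trans (isom_sym (isom_cancel X ba)) _.
by apply: isom_trans (isom_cancel Y ba); apply: isom_tens (isom_refl _) aXY.
Qed.

Lemma simple_sub X : nonzero X -> exists i (f : hom (simp C i) X), mono f.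
Proof.
move=> X_neq0; have [n [F [Fs [inj [prj [pi_id _ sum1]]]]]] := fus_semisimple X.
case: n F Fs inj prj pi_id sum1 => [|n] F Fs inj prj pi_id sum1.
  by case: X_neq0; rewrite -sum1 big_ord0.
have [i /isom_sym [f f_iso]] := simp_surj (Fs ord0).
exists i, (inj ord0 ∘ f); apply: mono_comp; last exact: iso_mono.
move=> W u v /(congr1 (comp (prj ord0))).
by rewrite !compA pi_id !compIm.
Qed.

Lemma dual_nonzero X : nonzero X -> nonzero (dual X).
Proof.
move=> X_neq0 dX0; apply: (ev_neq0 X_neq0).
by rewrite -[ev X]compmI -tensm_id dX0 wr0 comp0r.
Qed.

Lemma adjoint_one : adjoint_sub (one : C).
Proof. by move=> P [_ [P1 _ _]]. Qed.

Lemma adjoint_tens X Y : adjoint_sub X -> adjoint_sub Y -> adjoint_sub (X ⊗ Y).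
Proof.
by move=> aX aY P P_sub Py; case: (P_sub) => _ [_ PT _]; apply: PT; [apply: aX|apply: aY].
Qed.

Lemma adjoint_isom X Y : isom X Y -> adjoint_sub X -> adjoint_sub Y.
Proof.
move=> /isom_sym [f /iso_mono fM] aX P P_sub Py; case: (P_sub) => [[_ P_subobj] _].
exact: P_subobj fM (aX P P_sub Py).
Qed.

End Invertible.

Section InvertibleMonodromy.
Variables (k : closedFieldType) (C : braidedFusionCat k).
Implicit Types a X Y Z : C.

Lemma monodromy_exists a X : invertible a -> simple_obj X -> exists b, monodromy a X b.
Proof. by move=> a_inv Xs; apply: fus_simple_end; apply: invertible_tens_simple. Qed.

Lemma scale_idm_inj X (b c : k) : nonzero X -> b *: idm X = c *: idm X -> b = c.
Proof.
move=> /eqP X_neq0 /eqP; rewrite -subr_eq0 -scalerBl scaler_eq0 (negbTE X_neq0) orbF.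
by rewrite subr_eq0 => /eqP.
Qed.

Lemma monodromy_uniq a X b c :
  invertible a -> nonzero X -> monodromy a X b -> monodromy a X c -> b = c.
Proof.
move=> a_inv X_neq0; rewrite /monodromy => -> e.
exact: scale_idm_inj (invertible_nonzero a_inv X_neq0) e.
Qed.

Lemma monodromy_neq0 a X b : invertible a -> nonzero X -> monodromy a X b -> b != 0.
Proof.
move=> a_inv X_neq0 aX; apply/eqP => b0.
apply: (invertible_nonzero a_inv X_neq0).
apply: (iso_injl (is_iso_comp (braid_iso X a) (braid_iso a X))).
by rewrite aX b0 scale0r !comp0l.
Qed.

(** Morphisms commute with the double braiding with a, so they preserve its
    eigenvalue. *)
Lemma monodromy_hom0 a X Y b c : invertible a -> monodromy a X b -> monodromy a Y c -> b != c ->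
  \dim {:hom X Y} = 0%N.
Proof.
move=> a_inv aX aY bc; apply/eqP; rewrite dimv_eq0 -subv0; apply/subvP => f _.
rewrite memv0; apply/eqP; apply: (wl_inj a_inv); rewrite wl0.
move/eqP: (monodromy_hom f aX aY); rewrite -subr_eq0 -scalerBl scaler_eq0 subr_eq0.
by rewrite (negbTE bc) => /eqP.
Qed.

(** The scalar is idempotent because 1 ⊗ 1 is isomorphic to 1, and it is not
    zero. *)
Lemma monodromy_onel X : simple_obj X -> monodromy one X 1.
Proof.
move=> Xs; have [b oX] := monodromy_exists (invertible_one C) Xs.
have ooX : monodromy one X (b * b).
  by apply: monodromy_isoml (monodromy_tensl oX oX); apply: isom_lunit.
have b_neq0 := monodromy_neq0 (invertible_one C) (proj1 Xs) oX.
have := monodromy_uniq (invertible_one C) (proj1 Xs) ooX oX.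
by rewrite -[RHS]mul1r => /(mulIf b_neq0) b1; rewrite -b1.
Qed.

Lemma monodromy_oner a : invertible a -> monodromy a one 1.
Proof. by move=> a_inv; apply/monodromy_sym/monodromy_onel/invertible_simple. Qed.

(** Objects with trivial monodromy with a form a fusion subcategory. It
    contains every Y ⊗ Y^*, since the monodromies of Y and Y^* are inverse
    to each other. Hence the invertible objects centralize the adjoint
    subcategory. *)
Lemma monodromy_adjoint a X : invertible a -> adjoint_sub X -> monodromy a X 1.
Proof.
move=> a_inv aX; apply: (aX (fun X => monodromy a X 1)); last first.
  move=> Y Ys; have [b aY] := monodromy_exists a_inv Ys.
  have b_neq0 := monodromy_neq0 a_inv (proj1 Ys) aY.
  by rewrite -(mulfV b_neq0); apply: monodromy_tens aY (monodromy_dual b_neq0 aY).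
split; first split.
- by move=> n F S FS aF; apply: monodromy_dsum FS aF.
- by move=> Y Z i iM aY; apply: monodromy_sub iM aY.
split; first exact: monodromy_oner.
- by move=> Y Z aY aZ; rewrite -[1]mulr1; apply: monodromy_tens.
by move=> Y aY; rewrite -[1]invr1; apply: monodromy_dual; rewrite ?oner_neq0.
Qed.

Lemma selfbr_uniq a s t : invertible a -> selfbr a s -> selfbr a t -> s = t.
Proof.
move=> a_inv; rewrite /selfbr => -> e; apply: scale_idm_inj e.
by apply: invertible_nonzero => //; case: (invertible_simple a_inv).
Qed.

Lemma selfbr_one : selfbr (one : C) 1.
Proof.
have o_inv := invertible_one C.
have [s os] : exists s, selfbr (one : C) s.
  by apply: fus_simple_end; apply: invertible_tens_simple => //; apply: one_simple.
have := monodromy_oner o_inv => oo.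
have := selfbr_isom (isom_lunit one) (selfbr_tens os os oo).
rewrite mulr1 => /(selfbr_uniq o_inv) /(_ os).
suff s_neq0 : s != 0 by rewrite -[RHS]mul1r => /(mulIf s_neq0) s1; rewrite -[1]s1.
have [oo_neq0 _] := invertible_simple (invertible_tens o_inv o_inv).
apply/eqP => s0; apply: oo_neq0; apply: (iso_injl (braid_iso one one)).
by rewrite compmI comp0r os s0 scale0r.
Qed.

Definition tpow a n : C := iter n (tens a) one.

Lemma tpow_invertible a n : invertible a -> invertible (tpow a n).
Proof.
by move=> a_inv; elim: n => [|n IH]; [apply: invertible_one|apply: invertible_tens].
Qed.

Lemma tpow_adjoint a n : adjoint_sub a -> adjoint_sub (tpow a n).
Proof.
by move=> aa; elim: n => [|n IH]; [apply: adjoint_one|apply: adjoint_tens].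
Qed.

Lemma monodromy_tpow a X b n : simple_obj X -> monodromy a X b -> monodromy (tpow a n) X (b ^+ n).
Proof.
move=> Xs aX; elim: n => [|n IH]; first exact: monodromy_onel.
by rewrite exprS; apply: monodromy_tensl.
Qed.

Lemma selfbr_tpow a s n : selfbr a s -> (forall m, monodromy a (tpow a m) 1) ->
  selfbr (tpow a n) (s ^+ n).
Proof.
move=> aa a1; elim: n => [|n IH]; first exact: selfbr_one.
by rewrite exprS -[_ * _]mulr1; apply: selfbr_tens.
Qed.

(** The self-braiding s of a satisfies s ^+ 2 = 1 because the monodromy of a
    with itself is trivial. For the same reason self-braiding is
    multiplicative on powers of a, so s ^+ p = 1 as well. *)
Lemma selfbr_odd a p : invertible a -> adjoint_sub a -> odd p ->
  isom (tpow a p) one -> selfbr a 1.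
Proof.
move=> a_inv a_adj p_odd ap.
have [s aa] : exists s, selfbr a s.
  apply: fus_simple_end; apply: invertible_tens_simple => //.
  exact: invertible_simple.
have a_neq0 := proj1 (invertible_simple a_inv).
have ss : s * s = 1.
  apply: (monodromy_uniq a_inv a_neq0 _ (monodromy_adjoint a_inv a_adj)).
  by rewrite /monodromy aa compZl compZr compIm scalerA.
have sp : s ^+ p = 1.
  apply: (selfbr_uniq (invertible_one C) _ selfbr_one).
  apply: selfbr_isom ap _; apply: selfbr_tpow => // m.
  exact: monodromy_adjoint (tpow_adjoint m a_adj).
suff <- : s = 1 by [].
rewrite -sp -(odd_double_half p) p_odd exprS -muln2 exprM exprAC expr2 ss.
by rewrite expr1n mulr1.
Qed.

End InvertibleMonodromy.

(** * Fibers, ranks, and the action of invertible objects on simple ones *)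

Section Fibers.
Variables (T : finType) (K : eqType) (f : T -> K).

Definition values : seq K := undup [seq f i | i : T].

Lemma mem_values i : f i \in values.
Proof. by rewrite mem_undup map_f ?mem_enum. Qed.

Lemma card_fibers : #|T| = \sum_(c <- values) #|[set i | f i == c]|.
Proof.
under eq_bigr => c _ do rewrite -sum1dep_card big_mkcond /=.
rewrite exchange_big /= -sum1_card; apply: eq_bigr => i _.
rewrite -big_mkcond /= sum1_count -[LHS]/(nat_of_bool true) -(mem_values i).
rewrite -(count_uniq_mem _ (undup_uniq _)).
by apply: eq_count => c /=; rewrite eq_sym.
Qed.

(** Each value outside cs is attained at least once. *)
Lemma card_fibers_ge (cs : seq K) : uniq cs ->
  (\sum_(c <- cs) #|[set i | f i == c]| + size values <= #|T| + size cs)%N.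
Proof.
move=> cs_uniq; set F := fun c => #|[set i | f i == c]|.
have le_pred (s : seq K) : (\sum_(c <- s) F c <= \sum_(c <- s) (F c).-1 + size s)%N.
  rewrite -[size s]sum1_size -big_split /=; apply: leq_sum => c _.
  by rewrite addn1 leqSpred.
have eq_pred : (\sum_(c <- values) (F c).-1 + size values = #|T|)%N.
  rewrite card_fibers -[size values]sum1_size -big_split /=.
  rewrite big_seq_cond [RHS]big_seq_cond; apply: eq_bigr => c.
  rewrite andbT mem_undup => /mapP [i _ ->]; rewrite addn1 prednK //.
  by apply/card_gt0P; exists i; rewrite inE.
rewrite -eq_pred addnAC leq_add2r; apply: leq_trans (le_pred cs) _.
rewrite leq_add2r (bigID (mem values)) /= [X in (_ + X)%N]big1 ?addn0; last first.
  move=> c c_notin; rewrite /F (_ : [set i | _] = set0) ?cards0 //.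
  apply/setP => i; rewrite !inE; apply: contraNF c_notin => /eqP <-.
  exact: mem_values.
rewrite -big_filter (perm_big [seq c <- values | c \in cs]); last first.
  apply: uniq_perm; rewrite ?filter_uniq ?undup_uniq // => c.
  by rewrite !mem_filter andbC.
by rewrite big_filter big_mkcond; apply: leq_sum => c _; case: ifP.
Qed.

End Fibers.

(** The matrix factors through the set of values of f. *)
Lemma mxrank_values (F : fieldType) m n (K : eqType) (f : 'I_n -> K) (g : 'I_m -> K -> F) :
  (\rank (\matrix_(i < m, j < n) g i (f j)) <= size (values f))%N.
Proof.
set s := values f.
have -> : \matrix_(i < m, j < n) g i (f j) =
    (\matrix_(i < m, u < size s) g i (tnth (in_tuple s) u)) *m
    (\matrix_(u < size s, j < n) (tnth (in_tuple s) u == f j)%:R).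
  apply/matrixP => i j; rewrite !mxE.
  have ltj : (index (f j) s < size s)%N by rewrite index_mem mem_values.
  rewrite (bigD1 (Ordinal ltj)) //= !mxE (tnth_nth (f j)) /= nth_index ?mem_values //.
  rewrite eqxx mulr1 big1 ?addr0 // => u u_neq; rewrite !mxE.
  case: eqP => [fj|_]; last by rewrite mulr0.
  case/eqP: u_neq; apply: val_inj; rewrite /= -fj (tnth_nth (f j)) /=.
  by rewrite index_uniq // undup_uniq.
exact: leq_trans (mxrankM_maxl _ _) (rank_leq_col _).
Qed.

Lemma row_free_rowsub (F : fieldType) m n (f : 'I_m -> 'I_n) (S : 'M[F]_n) :
  S \in unitmx -> injective f -> row_free (rowsub f S).
Proof.
move=> S_unit f_inj; apply: inj_row_free => v.
rewrite rowsubE mulmxA => /(congr1 (mulmxr (invmx S))) /=.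
rewrite mulmxK // mul0mx => v0; apply/rowP => i.
have := congr1 (fun w : 'rV_n => w 0 (f i)) v0.
rewrite !mxE (bigD1 i) //= !mxE eqxx mulr1 big1 ?addr0 // => j j_neq.
by rewrite !mxE (inj_eq f_inj) (negbTE j_neq) mulr0.
Qed.

Lemma char_poly_perm (R : comNzRingType) n (s : 'S_n) (A B : 'M[R]_n) :
  (forall i j, B (s i) (s j) = A i j) -> char_poly B = char_poly A.
Proof.
move=> BA; rewrite /char_poly.
have -> : char_poly_mx A = row_perm s (col_perm s (char_poly_mx B)).
  by apply/matrixP => i j; rewrite !mxE BA (inj_eq perm_inj).
rewrite row_permE col_permE !det_mulmx !det_perm.
by rewrite odd_permV mulrCA -signr_addb addbb mulr1.
Qed.

Section Indices.
Variables (k : closedFieldType) (C : braidedFusionCat k).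
Notation I := 'I_(rank C).
Notation "''s_' i" := (simp C i) (at level 8, i at level 2, format "''s_' i").
Implicit Types (a b i j : I) (X Y : C).

Definition invs : {set I} := [set i | `[< invertible 's_i >]].

Lemma invsP i : reflect (invertible 's_i) (i \in invs).
Proof. by rewrite inE; apply: asboolP. Qed.

Lemma simp_nonzero i : nonzero 's_i.
Proof. by case: (simp_simple i). Qed.

Lemma simp_index X : simple_obj X -> {i : I | isom X 's_i}.
Proof. by move=> Xs; apply/cid/simp_surj. Qed.

Definition unit_index : I := sval (simp_index (one_simple C)).

Lemma unit_indexP : isom one 's_unit_index.
Proof. exact: svalP (simp_index (one_simple C)). Qed.

Lemma unit_invs : unit_index \in invs.
Proof. apply/invsP; apply: invertible_isom unit_indexP (invertible_one C). Qed.

(** The default value i is taken where s_a ⊗ s_i is not simple. *)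
Definition act a i : I :=
  if pselect (simple_obj ('s_a ⊗ 's_i)) is left H then sval (simp_index H) else i.

Lemma actP a i : a \in invs -> isom ('s_a ⊗ 's_i) 's_(act a i).
Proof.
move/invsP => a_inv; rewrite /act; case: pselect => [H|[]]; first exact: (svalP (simp_index H)).
by apply: invertible_tens_simple => //; apply: simp_simple.
Qed.

Lemma act_inj a : a \in invs -> injective (act a).
Proof.
move=> a_inv i j e; apply: simp_inj; have /invsP a_inv' := a_inv.
apply: (invertible_isom_inj a_inv'); apply: isom_trans (actP i a_inv) _.
by rewrite e; apply/isom_sym/actP.
Qed.

Lemma act_unit a : a \in invs -> act a unit_index = a.
Proof.
move=> a_inv; apply: simp_inj; apply: isom_trans (isom_sym (actP _ a_inv)) _.
apply: isom_trans (isom_runit _); apply: isom_tens (isom_refl _) _.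
exact/isom_sym/unit_indexP.
Qed.

Lemma act_invs a b : a \in invs -> b \in invs -> act a b \in invs.
Proof.
move=> a_inv b_inv; apply/invsP; apply: invertible_isom (actP b a_inv) _.
by apply: invertible_tens; apply/invsP.
Qed.

Lemma act_act a b i : a \in invs -> b \in invs -> act a (act b i) = act (act a b) i.
Proof.
move=> a_inv b_inv; apply: simp_inj.
apply: isom_trans (isom_sym (actP _ a_inv)) _.
apply: isom_trans (isom_tens (isom_refl _) (isom_sym (actP _ b_inv))) _.
apply: isom_trans (isom_sym (isom_assoc _ _ _)) _.
apply: isom_trans (isom_tens (actP _ a_inv) (isom_refl _)) _.
exact/actP/act_invs.
Qed.

Definition act_perm a : {perm I} :=
  if pselect (injective (act a)) is left H then perm H else 1%g.

Lemma act_permE a i : a \in invs -> act_perm a i = act a i.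
Proof.
move=> a_inv; rewrite /act_perm; case: pselect => [H|[]]; first by rewrite permE.
exact: act_inj.
Qed.

Lemma act_perm_inj : {in invs &, injective act_perm}.
Proof.
move=> a b a_inv b_inv e; rewrite -[a]act_unit // -[b]act_unit //.
by rewrite -!act_permE // e.
Qed.

Lemma act_permM a b : a \in invs -> b \in invs ->
  (act_perm b * act_perm a)%g = act_perm (act a b).
Proof.
move=> a_inv b_inv; apply/permP => i.
by rewrite permM !act_permE ?act_act ?act_invs.
Qed.

Definition adj_invs : {set I} := [set i | `[< adjoint_sub 's_i /\ invertible 's_i >]].

Lemma adj_invsP i : reflect (adjoint_sub 's_i /\ invertible 's_i) (i \in adj_invs).
Proof. by rewrite inE; apply: asboolP. Qed.

Lemma adj_invsW i : i \in adj_invs -> i \in invs.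
Proof. by case/adj_invsP => _ i_inv; apply/invsP. Qed.

Lemma adj_group_set : group_set (act_perm @: adj_invs).
Proof.
apply/group_setP; split.
  apply/imsetP; exists unit_index.
    apply/adj_invsP; split; last exact/invsP/unit_invs.
    exact: adjoint_isom unit_indexP (@adjoint_one k C).
  apply/permP => i; rewrite perm1 act_permE ?unit_invs //; apply: simp_inj.
  apply: isom_trans (actP i unit_invs); apply: isom_sym.
  apply: isom_trans (isom_tens (isom_sym unit_indexP) (isom_refl _)) _.
  exact: isom_lunit.
move=> _ _ /imsetP [b b_adj ->] /imsetP [a a_adj ->].
have [a_inv b_inv] := (adj_invsW a_adj, adj_invsW b_adj).
rewrite act_permM //; apply: imset_f; apply/adj_invsP; split.
  apply: adjoint_isom (actP b a_inv) _.
  by apply: adjoint_tens; [case/adj_invsP: a_adj|case/adj_invsP: b_adj].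
exact/invsP/act_invs.
Qed.

(** The invertible objects of the adjoint subcategory form a group of
    permutations of the simple objects, faithful because the image of the
    unit determines the element; Cauchy's theorem applies to this
    permutation group. *)
Lemma adj_cauchy p : prime p -> (p %| card_inv_sub (@adjoint_sub k C))%N ->
  exists2 g, g \in adj_invs & #[act_perm g]%g = p.
Proof.
move=> p_prime; rewrite /card_inv_sub -/adj_invs => p_dvd.
have p_dvd' : (p %| #|Group adj_group_set|)%N.
  rewrite card_in_imset // => a b /adj_invsW a_inv /adj_invsW b_inv.
  exact: act_perm_inj.
by have [_ /imsetP [g g_adj ->] g_p] := Cauchy p_prime p_dvd'; exists g.
Qed.

Lemma tpow_act a n i : a \in invs ->
  isom (tpow 's_a n ⊗ 's_i) 's_((act_perm a ^+ n)%g i).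
Proof.
move=> a_inv; elim: n => [|n IH]; first by rewrite expg0 perm1; apply: isom_lunit.
rewrite expgSr permM act_permE //.
apply: isom_trans (isom_assoc _ _ _) _; apply: isom_trans (actP _ a_inv).
exact: isom_tens (isom_refl _) IH.
Qed.

Definition mchar a i : k :=
  if pselect (exists x, monodromy 's_a 's_i x) is left H then sval (cid H) else 0.

Lemma mcharP a i : a \in invs -> monodromy 's_a 's_i (mchar a i).
Proof.
move/invsP => a_inv; rewrite /mchar; case: pselect => [H|[]]; first exact: (svalP (cid H)).
by apply: monodromy_exists => //; apply: simp_simple.
Qed.

Lemma mcharE a i x : a \in invs -> monodromy 's_a 's_i x -> mchar a i = x.
Proof.
move=> a_inv; apply: monodromy_uniq (mcharP i a_inv); first exact/invsP.
exact: simp_nonzero.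
Qed.

Lemma mchar_neq0 a i : a \in invs -> mchar a i != 0.
Proof.
move=> a_inv; apply: monodromy_neq0 (mcharP i a_inv); first exact/invsP.
exact: simp_nonzero.
Qed.

Lemma mchar_adj a i : a \in invs -> adjoint_sub 's_i -> mchar a i = 1.
Proof.
by move=> a_inv i_adj; apply: mcharE => //; apply: monodromy_adjoint => //; apply/invsP.
Qed.

Lemma mchar_act a b i : a \in invs -> b \in invs -> mchar a (act b i) = mchar a b * mchar a i.
Proof.
move=> a_inv b_inv; apply: mcharE => //; apply: monodromy_isom (actP i b_inv) _.
by apply: monodromy_tens; apply: mcharP.
Qed.

(** The restriction of the monodromy pairing to the invertible objects, as a
    function on simple ones. Its fibers are the components of a grading by
    the characters of the group of invertible objects; they serve in place
    of the universal grading. *)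
Definition mclass i : {ffun I -> k} := [ffun a => if a \in invs then mchar a i else 0].

Lemma mclassP i j : reflect {in invs, forall a, mchar a i = mchar a j} (mclass i == mclass j).
Proof.
apply: (iffP eqP) => [e a a_inv|e].
  by have := congr1 (fun f : {ffun I -> k} => f a) e; rewrite !ffunE a_inv.
by apply/ffunP => a; rewrite !ffunE; case: ifP => // /e.
Qed.

Lemma mclass_adj i : adjoint_sub 's_i -> mclass i = mclass unit_index.
Proof.
move=> i_adj; apply/eqP/mclassP => a a_inv; rewrite !mchar_adj //.
exact: adjoint_isom unit_indexP (@adjoint_one k C).
Qed.

(** The dual object need not be one of the chosen representatives, but any
    simple subobject of it has the same monodromies. *)
Lemma mchar_dual i : exists j, {in invs, forall a, mchar a j = (mchar a i)^-1}.
Proof.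
have [j [f fM]] := simple_sub (dual_nonzero (@simp_nonzero i)).
exists j => a a_inv; apply: mcharE => //; apply: monodromy_sub fM _.
by apply: monodromy_dual (mcharP i a_inv); apply: mchar_neq0.
Qed.

Lemma mchar_inverse b : b \in invs ->
  exists2 c, c \in invs & {in invs, forall a, mchar a c = (mchar a b)^-1}.
Proof.
move=> b_inv; have /invsP [Y [bY Yb]] := b_inv.
have Y_inv : invertible Y by exists 's_b.
have [c Yc] := simp_index (invertible_simple Y_inv).
have c_inv : c \in invs by apply/invsP; apply: invertible_isom Yc Y_inv.
exists c => // a a_inv; apply: (mulfI (mchar_neq0 b a_inv)).
rewrite mulfV ?mchar_neq0 // -mchar_act //; apply: mcharE => //.
apply: monodromy_isom (monodromy_oner (elimT (invsP a) a_inv)).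
apply: isom_trans (actP _ b_inv); apply: isom_sym.
by apply: isom_trans bY; apply: isom_tens (isom_refl _) (isom_sym Yc).
Qed.

End Indices.

(** * Invertible objects of odd prime order *)

Section OddOrder.
Variables (k : closedFieldType) (C : braidedFusionCat k).
Notation I := 'I_(rank C).
Variables (p : nat) (g : I).
Hypotheses (p_prime : prime p) (p_odd : odd p).
Hypotheses (g_adj : g \in adj_invs C) (g_order : #[act_perm g]%g = p).
Implicit Types (i j : I).

Let s : {perm I} := act_perm g.

Let g_inv : g \in invs C. Proof. exact: adj_invsW g_adj. Qed.
Let g_invertible : invertible (simp C g). Proof. exact/invsP. Qed.
Let g_adjoint : adjoint_sub (simp C g). Proof. by case/adj_invsP: g_adj. Qed.

Lemma tpow_order : isom (tpow (simp C g) p) one.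
Proof.
apply: isom_trans (isom_sym (isom_runit _)) _.
apply: isom_trans (isom_tens (isom_refl _) (unit_indexP C)) _.
apply: isom_trans (tpow_act _ _ g_inv) _.
by rewrite -g_order expg_order perm1; apply/isom_sym/unit_indexP.
Qed.

Lemma mchar_order i : mchar g i ^+ p = 1.
Proof.
have is_simple := simp_simple i.
have gp := monodromy_tpow p is_simple (mcharP i g_inv).
apply: (monodromy_uniq (invertible_one C) (@simp_nonzero _ _ i) _ (monodromy_onel is_simple)).
exact: monodromy_isoml tpow_order gp.
Qed.

(** This uses that p is odd: self-braiding of g is then trivial, and an
    object fixed by g has trivial monodromy with g. *)
Lemma act_neq i : mchar g i != 1 -> s i != i.
Proof.
apply: contraNN => /eqP si; apply/eqP.
have fixX : isom (simp C g ⊗ simp C i) (simp C i).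
  by apply: isom_trans (actP i g_inv) _; rewrite -act_permE // si; apply: isom_refl.
apply: fixed_monodromy (invertible_simple g_invertible) (simp_simple i) fixX _ (mcharP i g_inv).
exact: selfbr_odd g_invertible g_adjoint p_odd tpow_order.
Qed.

Lemma card_orbit_free i : mchar g i != 1 -> #|porbit s i| = p.
Proof.
move=> /act_neq si_neq.
have := dvdn_orbit 'P <[s]>%G i; rewrite -porbitE -orderE g_order.
case/primeP: (p_prime) => _ p_div /p_div /orP [/cards1P [j orb1]|/eqP //].
have := porbit_id s i; have := mem_porbit s 1 i; rewrite expg1 orb1 !inE.
by move=> /eqP si_j /eqP i_j; case/eqP: si_neq; rewrite si_j.
Qed.

Lemma mchar_pow a n i : a \in invs C -> mchar a ((s ^+ n)%g i) = mchar a i.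
Proof.
move=> a_inv; elim: n => [|n IH]; first by rewrite expg0 perm1.
by rewrite expgSr permM act_permE // mchar_act // mchar_adj // mul1r.
Qed.

Lemma mclass_orbit i j : j \in porbit s i -> mclass j = mclass i.
Proof.
by case/porbitP => n ->; apply/eqP/mclassP => a a_inv; apply: mchar_pow.
Qed.

Section Degree.
Variable i : I.
Hypothesis gi_neq1 : mchar g i != 1.
Let z := mchar g i.

Lemma prim_z : p.-primitive_root z.
Proof.
have p_gt0 := prime_gt0 p_prime.
have [m m_prim m_dvd] := prim_order_exists p_gt0 (mchar_order i).
case/primeP: p_prime => _ /(_ m m_dvd) /orP [/eqP m1|/eqP <- //].
by move: m_prim gi_neq1; rewrite m1 -/z => /prim_expr_order; rewrite expr1 => ->; rewrite eqxx.
Qed.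

Lemma deg_exists j : exists d : 'I_p, mchar g j == z ^+ d.
Proof. by have [d ->] := prim_rootP prim_z (mchar_order j); exists d. Qed.

(** The discrete logarithm of the monodromy with g, in base z. *)
Definition deg j : nat := xchoose (deg_exists j).

Lemma degP j : mchar g j = z ^+ deg j.
Proof. exact/eqP/(xchooseP (deg_exists j)). Qed.

Lemma deg_pow n j : deg ((s ^+ n)%g j) = deg j.
Proof.
have lt_deg m : (deg m < p)%N by rewrite /deg; apply: ltn_ord.
apply/eqP; rewrite -[deg (_ _)](modn_small (lt_deg _)).
rewrite -[deg j in X in _ == X](modn_small (lt_deg _)).
by rewrite -(eq_prim_root_expr prim_z) -!degP mchar_pow.
Qed.

Lemma shift_inj : injective (fun j => (s ^+ deg j)%g j).
Proof.
move=> j l /= e; have := congr1 deg e; rewrite !deg_pow => e_deg.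
by move: e; rewrite e_deg => /perm_inj.
Qed.

Definition shift : {perm I} := perm shift_inj.

(** Tensoring with i raises degrees by one. So where the fusion matrix of i
    has a nonzero entry, its target is shifted by one more power of g than
    its source, and this extra g is what distinguishes g ⊗ i from i:
    conjugation by shift turns one fusion matrix into the other. Conjugate
    matrices have the same characteristic polynomial, on which alone FPdim
    depends. *)
Lemma FPdim_act : FPdim (simp C (s i)) = FPdim (simp C i).
Proof.
rewrite /FPdim; suff -> : char_poly (mult_mx (simp C (s i))) = char_poly (mult_mx (simp C i)).
  by [].
apply: (char_poly_perm (s := shift)) => j l; rewrite !mxE !permE; congr (_%:R).
have monodromy_src : monodromy (simp C g) (simp C i ⊗ simp C j) (z ^+ (deg j).+1).
  by rewrite exprS -degP; apply: monodromy_tens; apply: mcharP.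
have monodromy_src' :
    monodromy (simp C g) (simp C (s i) ⊗ simp C ((s ^+ deg j)%g j)) (z ^+ (deg j).+1).
  rewrite exprS -degP -(mchar_pow (deg j) j g_inv) -[z](mchar_pow 1 i g_inv) expg1.
  by apply: monodromy_tens; apply: mcharP.
have monodromy_tgt : monodromy (simp C g) (simp C l) (z ^+ deg l) by rewrite -degP; apply: mcharP.
have monodromy_tgt' : monodromy (simp C g) (simp C ((s ^+ deg l)%g l)) (z ^+ deg l).
  by rewrite -degP -(mchar_pow (deg l) l g_inv); apply: mcharP.
have [e|ne] := eqVneq (z ^+ (deg j).+1) (z ^+ deg l); last first.
  rewrite (monodromy_hom0 g_invertible monodromy_src monodromy_tgt ne).
  by rewrite (monodromy_hom0 g_invertible monodromy_src' monodromy_tgt' ne).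
have -> : (s ^+ deg l)%g = (s ^+ (deg j).+1)%g.
  apply/eqP; rewrite eq_sym eq_expg_mod_order g_order.
  by rewrite -(eq_prim_root_expr prim_z) e.
rewrite -(invertible_dim (simp C i ⊗ simp C j) (simp C l)
  (tpow_invertible (deg j).+1 g_invertible)).
apply: isom_dim; last exact/isom_sym/tpow_act.
set G := simp C g; set X := simp C i; set P := tpow G (deg j).
apply: isom_trans (isom_tens (Y' := P ⊗ simp C j) (X' := G ⊗ X) _ _) _.
- by rewrite /s act_permE //; apply/isom_sym/actP.
- exact/isom_sym/tpow_act.
apply: isom_trans (isom_assoc _ _ _) _.
apply: isom_trans _ (isom_sym (isom_assoc _ _ _)).
apply: isom_tens (isom_refl _) _.
by exists (braidZ X P (simp C j)); apply: braidZ_iso.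
Qed.

End Degree.

Lemma FPdim_orbit i j : mchar g i != 1 -> j \in porbit s i ->
  FPdim (simp C j) = FPdim (simp C i).
Proof.
move=> gi /porbitP [n ->]; elim: n => [|n IH]; first by rewrite expg0 perm1.
rewrite expgSr permM -IH; apply: FPdim_act.
by rewrite mchar_pow.
Qed.

End OddOrder.

(** * Nondegeneracy of the monodromy pairing *)

Section Modular.
Variables (k : closedFieldType) (C : modularCat k).
Notation I := 'I_(rank C).
Implicit Types (a b c i j : I).

Let d i := cdim (@spher _ C) (simp C i).

(** The double braiding with an invertible object is a scalar, and what
    remains of the trace is the product of the dimensions. *)
Lemma S_matrix_row a i : a \in invs C -> S_matrix (@spher _ C) a i = d a * mchar a i * d i.
Proof.
move=> a_inv; rewrite mxE (mcharP i a_inv) ptrace_scale.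
rewrite cdim_tens; last by case: (spher_spherical C).
by rewrite mulrCA mulrA.
Qed.

Let G := invs C.
Let B := \matrix_(u < #|G|, i < rank C) mchar (enum_val u) i.

(** Up to diagonal factors, these are rows of the invertible S-matrix. *)
Lemma row_free_mchar : row_free B.
Proof.
have := row_free_rowsub (S_unit C) (@enum_val_inj _ (mem G)).
have -> : rowsub (enum_val (A := mem G)) (S_matrix (@spher _ C)) =
    diag_mx (\row_u d (enum_val u)) *m B *m diag_mx (\row_i d i).
  apply/matrixP => u i; rewrite mxE S_matrix_row; last exact: (enum_valP u).
  by rewrite mul_mx_diag mxE mul_diag_mx !mxE.
rewrite /row_free => /eqP rankS; rewrite eqn_leq rank_leq_row -{1}rankS.
exact: leq_trans (mxrankM_maxl _ _) (mxrankM_maxr _ _).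
Qed.

Lemma mchar_sep a b : a \in G -> b \in G -> (forall i, mchar a i = mchar b i) -> a = b.
Proof.
move=> aG bG ab; pose u := enum_rank_in aG a; pose v := enum_rank_in aG b.
have uv : row u B = row v B.
  by apply/rowP => i; rewrite !mxE !enum_rankK_in.
have : (delta_mx 0 u : 'rV_#|G|) *m B == delta_mx 0 v *m B by rewrite -!rowE uv.
move/eqP/(row_free_inj row_free_mchar)/(congr1 (fun x : 'rV_#|G| => x 0 u)).
rewrite !mxE !eqxx /=; case: eqP => [uv' _|_ /eqP]; last by rewrite oner_eq0.
by have := congr1 enum_val uv'; rewrite !enum_rankK_in.
Qed.

(** The columns of this matrix depend only on the class, and its rank is the
    number of invertible objects. *)
Lemma card_classes : (#|G| <= size (values (@mclass _ C)))%N.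
Proof.
rewrite -(eqP row_free_mchar).
have -> : B = \matrix_(u, i) (fun (u : 'I_#|G|) (f : {ffun I -> k}) => f (enum_val u)) u (mclass i).
  by apply/matrixP => u i; rewrite !mxE ffunE (enum_valP u).
exact: (mxrank_values (@mclass _ C) (fun (u : 'I_#|G|) (f : {ffun I -> k}) => f (enum_val u))).
Qed.

(** An adjoint invertible object has the same class as the unit, so the
    invertible objects occupy fewer classes than their number, while there
    are at least as many classes as invertible objects. *)
Lemma class_not_invertible g : g \in adj_invs C -> g != unit_index C ->
  exists i, {in G, forall b, mclass b != mclass i}.
Proof.
move=> g_adj g_neq.
have [//|no_i] := pselect (exists i, {in G, forall b, mclass b != mclass i}).
have sub : {subset values (@mclass _ C) <= [seq mclass b | b in G :\ g]}.
  move=> c; rewrite mem_undup => /mapP [i _ ->].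
  have [b bG bi] : exists2 b, b \in G & mclass b = mclass i.
    apply: contrapT => no_b; apply: no_i; exists i => b bG.
    by apply/eqP => bi; apply: no_b; exists b.
  have [bg|b_neq] := eqVneq b g; last by apply/imageP; exists b; rewrite ?in_setD1 ?b_neq.
  apply/imageP; exists (unit_index C); first by rewrite in_setD1 eq_sym g_neq unit_invs.
  by rewrite -bi bg; apply: mclass_adj; case/adj_invsP: g_adj.
have := uniq_leq_size (undup_uniq _) sub; rewrite size_map -cardE.
rewrite leqNgt (leq_trans _ card_classes) //.
by rewrite [X in (_ < X)%N](cardsD1 g) (adj_invsW g_adj).
Qed.

(** The classes on which g has trivial monodromy and the classes of
    invertible objects are both proper subgroups of the group of classes,
    and a group is not the union of two proper subgroups. *)
Lemma separating_class g : g \in adj_invs C -> g != unit_index C ->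
  exists i, mchar g i != 1 /\ {in G, forall b, mclass b != mclass i}.
Proof.
move=> g_adj g_neq; have gG := adj_invsW g_adj.
have [x gx] : exists i, mchar g i != 1.
  apply: contrapT => no_i; case/eqP: g_neq; apply: (mchar_sep gG (unit_invs C)) => i.
  have -> : mchar g i = 1 by apply/eqP; apply: contrapT => /negP gi; apply: no_i; exists i.
  rewrite (mcharE (unit_invs C) (x := 1)) //.
  exact: monodromy_isoml (unit_indexP C) (monodromy_onel (simp_simple i)).
have [y y_class] := class_not_invertible g_adj g_neq.
have [gy|] := eqVneq (mchar g y) 1; last by exists y.
have [x_class|/existsPNP] := pselect {in G, forall b, mclass b != mclass x}; first by exists x.
move=> [a aG /negP /negPn /eqP ax].
have ga : mchar g a != 1 by have /eqP /mclassP -> := ax.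
(* x has the class of the invertible a, and g has trivial monodromy with y:
   the product of a and y avoids both subgroups. *)
exists (act a y); rewrite mchar_act // gy mulr1; split=> // b bG.
apply/negP => /mclassP b_class.
have [c cG c_inv] := mchar_inverse aG.
have := y_class (act c b) (act_invs cG bG); case/mclassP => e eG.
by rewrite mchar_act // c_inv // b_class // mchar_act // mulKf ?mchar_neq0.
Qed.

End Modular.

(** * The count *)

(** A simple object is isomorphic to any of the nonzero homogeneous summands
    of its decomposition. *)
Lemma grading_simple (k : closedFieldType) (C : fusionCat k) (U : groupType)
    (D : U -> C -> Prop) (X : C) :
  grading D -> simple_obj X -> exists h, D h X.
Proof.
move=> D_gr Xs; have [n [F [u [DF [inj [prj [pi_id _ sum1]]]]]]] := gr_dec D_gr X.
have [j Fj] : exists j, nonzero (F j).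
  apply: contrapT => F0; case: (Xs) => + _; apply; rewrite -sum1 big1 // => j _.
  suff e : idm (F j) = 0 by rewrite -[prj j]compIm e comp0l comp0r.
  by apply: contrapT => Fj; apply: F0; exists j.
have injM : mono (inj j).
  by move=> W f f' /(congr1 (comp (prj j))); rewrite !compA pi_id !compIm.
have [f' ff'] := simple_mono_iso Fj Xs injM.
exists (u j); case: (gr_sub D_gr (u j)) => _ sub.
by apply: sub (DF j); apply: iso_mono; exists (inj j); apply: inverse_pairC ff'.
Qed.

(** A free orbit of g lies in a single class. *)
Lemma card_porbit_le (k : closedFieldType) (C : braidedFusionCat k) (p : nat)
    (g i : 'I_(rank C)) :
  prime p -> odd p -> g \in adj_invs C -> #[act_perm g]%g = p -> mchar g i != 1 ->
  (p <= #|[set j | mclass j == mclass i]|)%N.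
Proof.
move=> p_prime p_odd g_adj g_order gi.
rewrite -(card_orbit_free p_prime p_odd g_adj g_order gi); apply: subset_leq_card.
by apply/subsetP => j /(mclass_orbit g_adj) e; rewrite inE e.
Qed.

Lemma bound2 (a n0 p n1 c v r : nat) :
  (a <= n0 -> p <= n1 -> c <= v -> n0 + (n1 + 0) + v <= r + 2 -> a + c + p - 2 <= r)%N.
Proof. lia. Qed.

Lemma bound3 (a n0 p n1 n2 c v r : nat) :
  (a <= n0 -> p <= n1 -> p <= n2 -> c <= v ->
   n0 + (n1 + (n2 + 0)) + v <= r + 3 -> a + c + 2 * p - 3 <= r)%N.
Proof. lia. Qed.

Theorem lemma5p1 (k : closedFieldType) (char0 : [pchar k] =i pred0)
    (C : modularCat k) (p : nat) (p_prime : prime p) (p_odd : odd p)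
    (p_dvd : (p %| card_inv_sub (@adjoint_sub k C))%N) :
  [/\ forall (U : groupType) (D : U -> C -> Prop), universal_grading D ->
        exists (h : U) (A : {set 'I_(rank C)}) (d : algC),
          [/\ h != 1%g, (p <= #|A|)%N
            & forall i, i \in A ->
                [/\ D h (simp C i), ~ invertible (simp C i)
                  & FPdim (simp C i) = d]],
      ~ pointed C ->
        (rank_sub (@adjoint_sub k C) + card_inv C + p - 2 <= rank C)%N
    & odd_dimensional C ->
        (rank_sub (@adjoint_sub k C) + card_inv C + 2 * p - 3 <= rank C)%N].
Proof.
have [g g_adj g_order] := adj_cauchy p_prime p_dvd.
have gG := adj_invsW g_adj.
have g_neq : g != unit_index C.
  apply/eqP => g1; have := prime_gt1 p_prime; rewrite -g_order order_gt1 => /eqP; apply.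
  apply/permP => i; rewrite perm1 act_permE //; apply: simp_inj.
  apply: isom_trans (isom_sym (actP i gG)) _; rewrite g1.
  apply: isom_trans (isom_lunit _).
  exact: isom_tens (isom_sym (unit_indexP C)) (isom_refl _).
have [z [gz z_class]] := separating_class g_adj g_neq.
have orbit_z := card_porbit_le p_prime p_odd g_adj g_order gz.
have z_neq1 : mclass (unit_index C) != mclass z by apply/z_class/unit_invs.
have card_G : card_inv C = #|invs C|.
  by apply: eq_card => i; rewrite !inE; apply: asbool_equiv_eq; split => [[]|].
have le_adj : (rank_sub (@adjoint_sub k C) <=
    #|[set i | mclass i == mclass (unit_index C)]|)%N.
  apply: subset_leq_card; apply/subsetP => i; rewrite !inE => /asboolP i_adj.
  by rewrite (mclass_adj i_adj).
have classes := card_classes C.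
split.
- move=> U D [D_gr _ D1].
  have [h Dh] := grading_simple D_gr (simp_simple z).
  exists h, (porbit (act_perm g) z), (FPdim (simp C z)); split.
  + apply: contraNneq gz => h1; rewrite mchar_adj //; apply/D1.
    by rewrite -h1.
  + by rewrite (card_orbit_free p_prime p_odd g_adj g_order gz).
  move=> i i_orb; split; last exact: (FPdim_orbit p_prime g_adj g_order gz i_orb).
    (* g lies in the trivial component, so its powers preserve the component
       of z. *)
    have /porbitP [n ->] := i_orb.
    case: (gr_sub D_gr h) => _ sub.
    have [f [f' ff']] := tpow_act n z gG.
    apply: (sub _ _ f'); first by apply: iso_mono; exists f; apply: inverse_pairC.
    rewrite -[h]mul1g; apply: gr_tens => //; apply/D1.
    by apply: tpow_adjoint; case/adj_invsP: g_adj.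
  move/invsP => iG; have := z_class _ iG.
  by rewrite (mclass_orbit g_adj i_orb) eqxx.
- move=> _.
  have := @card_fibers_ge _ _ (@mclass _ C) [:: mclass (unit_index C); mclass z].
  rewrite /= !inE z_neq1 => /(_ isT); rewrite !big_cons big_nil card_ord card_G.
  exact: bound2 le_adj orbit_z classes.
(* The dual class is a further one, with p more objects: monodromies with g
   are p-th roots of unity, and p is odd. *)
move=> _; have [z' z'P] := mchar_dual z.
have gz' : mchar g z' != 1 by rewrite z'P // invr_eq1.
have orbit_z' := card_porbit_le p_prime p_odd g_adj g_order gz'.
have z'_neq1 : mclass (unit_index C) != mclass z'.
  apply: contraNneq gz' => /eqP /mclassP <- //.
  by rewrite mchar_adj //; apply: adjoint_isom (unit_indexP C) (@adjoint_one k C).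
have z'_neqz : mclass z != mclass z'.
  apply: contraNneq gz => /eqP /mclassP /(_ g gG); rewrite z'P // => e.
  have zz : mchar g z ^+ 2 = 1 by rewrite expr2 {2}e mulfV ?mchar_neq0.
  have := mchar_order g_adj g_order z.
  rewrite -(odd_double_half p) p_odd exprS -muln2 mulnC exprM zz expr1n mulr1.
  by move=> ->.
have := @card_fibers_ge _ _ (@mclass _ C)
  [:: mclass (unit_index C); mclass z; mclass z'].
rewrite /= !inE negb_or z_neq1 z'_neq1 z'_neqz => /(_ isT).
rewrite !big_cons big_nil card_ord card_G.
exact: bound3 le_adj orbit_z orbit_z' classes.
Qed.
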